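(* For any convex body $K\subset\mathbb{R}^2$ with the origin $o$ in its interior, we have $$\lambda_1(K)\,\lambda_1((K-K)^* )\le 3,$$ and equality holds if and only if $K=\lambda U\cdot\mathrm{conv}\{(-1,-1),(-1,2),(2,-1)\}$ for some $\lambda>0$ and $U\in\mathrm{GL}_2(\mathbb{Z})$.
   Context: A convex body in $\mathbb{R}^d$ is a non-empty compact convex subset of $\mathbb{R}^d$. For a convex body $C\subset\mathbb{R}^d$ with $o\in\mathrm{int}(C)$, the first successive minimum is $\lambda_1(C)=\min\{\lambda\ge 0:\lambda C\cap\mathbb{Z}^d\ne\{o\}\}$. $K-K=\{x-y:x,y\in K\}$ is the difference body, and $X^*=\{y\in\mathbb{R}^d:\langle x,y\rangle\le 1\ \forall x\in X\}$ is the polar set of $X$. *)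

(* Defs.v *)
From HB Require Import structures.
From mathcomp Require Import all_boot all_order all_algebra.
From mathcomp Require Import all_classical all_reals all_analysis.

Set Implicit Arguments.
Unset Strict Implicit.
Unset Printing Implicit Defensive.

Import Order.TTheory GRing.Theory Num.Theory.
Import numFieldNormedType.Exports.

Local Open Scope classical_set_scope.
Local Open Scope ring_scope.

Section ConvexGeometry.
Context {R : realType} {d : nat}.
Implicit Types (x y : 'cV[R]_d) (A C K X : set 'cV[R]_d).

Definition dotv x y : R := \sum_(i < d) x i 0 * y i 0.

Definition is_convex_body K : Prop :=
  [/\ K !=set0, compact K & convex_set K].

Definition conv_hull A : set 'cV[R]_d := smallest (fun C => convex_set C) A.

Definition scale_set (l : R) A : set 'cV[R]_d := [set l *: x | x in A].

Definition int_lattice : set 'cV[R]_d :=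
  [set x | forall i, x i 0 \is a Num.int].

(* The least element of a set of reals. The default 0 is only taken when there
   is no least element; the minimum in [lambda1 C] is attained whenever d > 0
   and C is a convex body with 0 in its interior. *)
Definition least (S : set R) : R := xget 0 (S `&` lbound S).

Definition lambda1 C : R :=
  least [set l | 0 <= l /\ scale_set l C `&` int_lattice <> [set 0]].

Definition difference_body K : set 'cV[R]_d := [set x - y | x in K & y in K].

Definition polar X : set 'cV[R]_d := [set y | forall x, X x -> dotv x y <= 1].

Definition int_mx_image (U : 'M[int]_d) A : set 'cV[R]_d :=
  [set map_mx intr U *m x | x in A].

End ConvexGeometry.

Definition point2 {R : realType} (a b : R) : 'cV[R]_2 :=
  \col_(i < 2) (if i == 0 then a else b).

Definition triangle {R : realType} : set 'cV[R]_2 :=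
  conv_hull [set point2 (-1) (-1); point2 (-1) 2; point2 2 (-1)].

(* Main.v *)
Require Import Defs.
From HB Require Import structures.
From mathcomp Require Import all_boot all_order all_algebra.
From mathcomp Require Import all_classical all_reals all_analysis.
From mathcomp Require Import ring lra zify.

Set Implicit Arguments.
Unset Strict Implicit.
Unset Printing Implicit Defensive.

Import Order.TTheory GRing.Theory Num.Theory.
Import numFieldNormedType.Exports.

Local Open Scope classical_set_scope.
Local Open Scope ring_scope.

(* If lambda1 K * lambda1 (K - K)^* >= 3, then K scaled by lambda1 K has no
   nonzero lattice point in its interior and lattice width at least 3 in every
   direction; this forces a unimodular image of the triangle, for which the
   product is exactly 3.

   Fix a basis w0, w1 of the lattice and the hexagon w0, w1, w2 = w1 - w0,
   w3 = - w0, w4 = - w1, w5 = - w2, with the forms f0 = x + y, f1 = y,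
   f2 = - x, f_(i+3) = - f_i, so that f_i = 1 on the edge from w_i to w_(i+1).
   Each w_i is cut off from K by a line (1 - t_i) f_(i-1) + t_i f_i <= 1.
   If every t_i lies in [0, 1], then E_i = max f_i - 1 is at most 1 - t_i and
   at most t_(i+1), so E_i + E_(i+1) <= 1.  The three widths give
   E_i + E_(i+3) >= 1, so all these are equalities, which leaves only the two
   triangles spanned by alternate vectors w_i + w_(i+1).

   A line with t_i outside [0, 1] is tilted.  Replacing the basis w0, w1 by
   w0, w0 + w1 as long as the cone of two neighbouring w_i contains points of
   K beyond both of them (which stops since K is bounded) makes tilted lines
   non-adjacent.  Each remaining pattern of tilted lines contradicts the
   widths, except one, realised by the triangle in another basis. *)

Section PlanarBodies.
Context {R : realType}.
Implicit Types (K : R -> R -> Prop) (x y t : R).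

(** * Planar sets in lattice coordinates *)

Definition convex2 K := forall x y x' y' t, K x y -> K x' y' -> 0 <= t <= 1 ->
  K (t * x + (1 - t) * x') (t * y + (1 - t) * y').

(** Two witnessing points stand for the width, so that no supremum has to be handled. *)
Definition wide K (m n : R) := exists x y x' y',
  [/\ K x y, K x' y' & 3 <= (m * x + n * y) - (m * x' + n * y')].

Definition lattice_wide K :=
  forall m n : int, (m, n) != (0, 0) -> wide K m%:~R n%:~R.

(** The edge description of the hull of (-1, -1), (2, -1) and (-1, 2); see [triangleP]. *)
Definition in_triangle x y := [/\ -1 <= x, -1 <= y & x + y <= 1].

(** The matrix sends K to the triangle rather than the triangle to K, which keeps membership in K a
    system of linear inequalities. *)
Definition unimod_triangle K := exists p q r s : int,
  (p * s - q * r = 1 \/ p * s - q * r = -1) /\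
  forall x y, K x y <->
    in_triangle (p%:~R * x + q%:~R * y) (r%:~R * x + s%:~R * y).

(* K in the coordinates of the bases (w1, w2), (w1, w0) and (w0, w0 + w1). *)
Definition hex_rot K x y := K (- y) (x + y).
Definition hex_mir K x y := K y x.
Definition hex_shear K x y := K (x + y) y.

Lemma hex_rotE K x y : K x y = hex_rot K (x + y) (- x).
Proof. by rewrite /hex_rot opprK; congr K; lra. Qed.

Lemma hex_shearE K x y : K x y = hex_shear K (x - y) y.
Proof. by rewrite /hex_shear subrK. Qed.

Lemma convex2_rot K : convex2 K -> convex2 (hex_rot K).
Proof.
move=> cK x y x' y' t h h' ht; rewrite /hex_rot.
have := cK _ _ _ _ _ h h' ht.
by congr K; lra.
Qed.

Lemma convex2_mir K : convex2 K -> convex2 (hex_mir K).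
Proof. by move=> cK x y x' y' t h h' ht; apply: cK. Qed.

Lemma convex2_shear K : convex2 K -> convex2 (hex_shear K).
Proof.
move=> cK x y x' y' t h h' ht; rewrite /hex_shear.
have := cK _ _ _ _ _ h h' ht.
by congr K; lra.
Qed.

Lemma lattice_wide_rot K : lattice_wide K -> lattice_wide (hex_rot K).
Proof.
move=> wK m n mn; have [|x [y [x' [y' [h h' hw]]]]] := wK (m - n) m.
  by apply: contra mn; rewrite !xpair_eqE subr_eq0 => /andP[/eqP -> ->].
exists (x + y), (- x), (x' + y'), (- x'); rewrite -!hex_rotE; split => //.
by move: hw; rewrite rmorphB /=; lra.
Qed.

Lemma lattice_wide_mir K : lattice_wide K -> lattice_wide (hex_mir K).
Proof.
move=> wK m n mn; have [|x [y [x' [y' [h h' hw]]]]] := wK n m.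
  by apply: contra mn; rewrite !xpair_eqE andbC.
by exists y, x, y', x'; split => //; lra.
Qed.

Lemma lattice_wide_shear K : lattice_wide K -> lattice_wide (hex_shear K).
Proof.
move=> wK m n mn; have [|x [y [x' [y' [h h' hw]]]]] := wK m (n - m).
  apply: contra mn; rewrite !xpair_eqE subr_eq0 => /andP[/eqP -> /eqP ->].
  by rewrite eqxx.
exists (x - y), y, (x' - y'), y'; rewrite -!hex_shearE; split => //.
by move: hw; rewrite rmorphB /=; lra.
Qed.

Lemma unimod_triangle_rot K :
  unimod_triangle (hex_rot K) -> unimod_triangle K.
Proof.
move=> [p [q [r [s [d h]]]]]; exists (p - q), p, (r - s), r; split.
  by case: d => d; [left|right]; lra.
move=> x y; rewrite hex_rotE h !rmorphB /=.
by rewrite (_ : p%:~R * (x + y) + _ = (p%:~R - q%:~R) * x + p%:~R * y);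
  [rewrite (_ : r%:~R * (x + y) + _ = (r%:~R - s%:~R) * x + r%:~R * y)|];
  rewrite //; ring.
Qed.

Lemma unimod_triangle_mir K :
  unimod_triangle (hex_mir K) -> unimod_triangle K.
Proof.
move=> [p [q [r [s [d h]]]]]; exists q, p, s, r; split.
  by case: d => d; [right|left]; lra.
move=> x y; rewrite -[K x y]/(hex_mir K y x) h.
by rewrite [_ * y + _]addrC [r%:~R * y + _]addrC.
Qed.

Lemma unimod_triangle_shear K :
  unimod_triangle (hex_shear K) -> unimod_triangle K.
Proof.
move=> [p [q [r [s [d h]]]]]; exists p, (q - p), r, (s - r); split.
  by case: d => d; [left|right]; lra.
move=> x y; rewrite hex_shearE h !rmorphB /=.
by rewrite (_ : p%:~R * (x - y) + _ = p%:~R * x + (q%:~R - p%:~R) * y);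
  [rewrite (_ : r%:~R * (x - y) + _ = r%:~R * x + (s%:~R - r%:~R) * y)|];
  rewrite //; ring.
Qed.

Lemma convex2_comb3 K x1 y1 x2 y2 x3 y3 a b c : convex2 K ->
  K x1 y1 -> K x2 y2 -> K x3 y3 -> 0 <= a -> 0 <= b -> 0 <= c ->
  a + b + c = 1 ->
  K (a * x1 + b * x2 + c * x3) (a * y1 + b * y2 + c * y3).
Proof.
move=> cK h1 h2 h3 a0 b0 c0 abc.
have [ab|ab] := eqVneq (a + b) 0.
  have [-> [-> ->]] : a = 0 /\ b = 0 /\ c = 1 by repeat split; lra.
  by rewrite !mul0r !add0r !mul1r.
have abp : 0 < a + b by rewrite lt_neqAle eq_sym ab addr_ge0.
have ht : 0 <= a / (a + b) <= 1.
  rewrite ler_pdivrMr // mul1r lerDl b0 andbT.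
  by apply: divr_ge0 => //; apply: ltW.
have := cK _ _ _ _ (a + b) (cK _ _ _ _ _ h1 h2 ht) h3.
have -> : 0 <= a + b <= 1 by apply/andP; split; lra.
move=> /(_ isT); have -> : 1 - (a + b) = c by lra.
by congr K; field.
Qed.

(* The line of [cut_i] passes through w_i; both neighbours of w_i satisfy the
   inequality exactly when 0 <= t_i <= 1. *)
Record hexcut K (t0 t1 t2 t3 t4 t5 : R) : Prop := Hexcut {
  cut0 : forall x y, K x y -> x + t0 * y <= 1 ;
  cut1 : forall x y, K x y -> (1 - t1) * x + y <= 1 ;
  cut2 : forall x y, K x y -> (1 - t2) * y - t2 * x <= 1 ;
  cut3 : forall x y, K x y -> - x - t3 * y <= 1 ;
  cut4 : forall x y, K x y -> - (1 - t4) * x - y <= 1 ;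
  cut5 : forall x y, K x y -> t5 * x - (1 - t5) * y <= 1 }.

Lemma hexcut_rot K t0 t1 t2 t3 t4 t5 :
  hexcut K t0 t1 t2 t3 t4 t5 -> hexcut (hex_rot K) t1 t2 t3 t4 t5 t0.
Proof.
by move=> [h0 h1 h2 h3 h4 h5]; split => x y;
 [move/h1|move/h2|move/h3|move/h4|move/h5|move/h0]; lra.
Qed.

(** Exchanging w0 and w1 reverses the cyclic order, so t_i becomes 1 - t_(1-i), indices modulo 6. *)
Lemma hexcut_mir K t0 t1 t2 t3 t4 t5 :
  hexcut K t0 t1 t2 t3 t4 t5 ->
  hexcut (hex_mir K) (1 - t1) (1 - t0) (1 - t5) (1 - t4) (1 - t3) (1 - t2).
Proof.
by move=> [h0 h1 h2 h3 h4 h5]; split => x y;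
 [move/h1|move/h0|move/h5|move/h4|move/h3|move/h2]; lra.
Qed.

(* In the next three lemmas x stands for f_i and y for - f_(i-1), and the
   inequalities are the cuts at w_i and w_(i+1). *)
Lemma edge_le_left (s t x y : R) :
  s <= 1 -> 0 <= t <= 1 ->
  s * x - (1 - s) * y <= 1 -> x + t * y <= 1 -> x - 1 <= 1 - s.
Proof.
move=> s1 /andP[t0 t1] h1 h2.
have [e0|e0] := lerP x 1; first by lra.
have y0 : y <= 0.
  have [//|y0] := lerP y 0; have := mulr_ge0 t0 (ltW y0); lra.
(* As y <= 0 and t <= 1, the second cut implies the one with t = 1. *)
have y1 : y <= 1 - x by nra.
nra.
Qed.

Lemma edge_le_right (s t x y : R) :
  0 <= s <= 1 -> 0 <= t ->
  s * x - (1 - s) * y <= 1 -> x + t * y <= 1 -> x - 1 <= t.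
Proof.
move=> /andP[s0 s1] t0 h1 h2.
have [e0|e0] := lerP x 1; first by lra.
have [y0|y0] := lerP (-1) y; first by nra.
have [s2|s2] := lerP s 0; nra.
Qed.

Lemma edge_le_mul (s t x y : R) : s <= 1 -> 0 <= t ->
  s * x - (1 - s) * y <= 1 -> x + t * y <= 1 ->
  (x - 1) * (1 - s * (1 - t)) <= (1 - s) * t.
Proof. by move=> *; nra. Qed.

(** Cuts put K inside a unimodular triangle, extremal points of K are its vertices, and convexity
    fills in the rest. *)
Lemma triangle_of_vertices K x1 y1 x2 y2 x3 y3 : convex2 K ->
  K x1 y1 -> K x2 y2 -> K x3 y3 -> forall (p q r s : int),
  (p * s - q * r = 1 \/ p * s - q * r = -1) ->
  (forall x y, K x y ->
    in_triangle (p%:~R * x + q%:~R * y) (r%:~R * x + s%:~R * y)) ->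
  (p%:~R * x1 + q%:~R * y1 = -1) -> (r%:~R * x1 + s%:~R * y1 = -1) ->
  (p%:~R * x2 + q%:~R * y2 = 2) -> (r%:~R * x2 + s%:~R * y2 = -1) ->
  (p%:~R * x3 + q%:~R * y3 = -1) -> (r%:~R * x3 + s%:~R * y3 = 2) ->
  unimod_triangle K.
Proof.
move=> cK h1 h2 h3 p q r s d sub e1 e2 e3 e4 e5 e6.
exists p, q, r, s; split=> // x y; split; first exact: sub.
move=> [t1 t2 t3].
set u := p%:~R * x + q%:~R * y in t1 t3 *.
set v := r%:~R * x + s%:~R * y in t2 t3 *.
(* Barycentric coordinates of (u, v) with respect to (-1, -1), (2, -1), (-1, 2). *)
pose a := (1 - u - v) / 3; pose b := (1 + u) / 3; pose c := (1 + v) / 3.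
pose x' := a * x1 + b * x2 + c * x3; pose y' := a * y1 + b * y2 + c * y3.
have k : K x' y' by apply: convex2_comb3; rewrite // /a /b /c; lra.
have ex : p%:~R * x' + q%:~R * y' = u.
  transitivity (a * (p%:~R * x1 + q%:~R * y1) + b * (p%:~R * x2 + q%:~R * y2)
    + c * (p%:~R * x3 + q%:~R * y3)); first by rewrite /x' /y'; ring.
  by rewrite e1 e3 e5 /a /b /c; field.
have ey : r%:~R * x' + s%:~R * y' = v.
  transitivity (a * (r%:~R * x1 + s%:~R * y1) + b * (r%:~R * x2 + s%:~R * y2)
    + c * (r%:~R * x3 + s%:~R * y3)); first by rewrite /x' /y'; ring.
  by rewrite e2 e4 e6 /a /b /c; field.
(* Both points have the image (u, v); Cramer's rule makes them equal. *)
have dn : p%:~R * s%:~R - q%:~R * r%:~R != 0 :> R.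
  by rewrite -!rmorphM -rmorphB intr_eq0; case: d => ->.
suff [<- <-] : x' = x /\ y' = y by [].
split; apply: (mulfI dn).
  transitivity (s%:~R * u - q%:~R * v); last by rewrite /u /v; ring.
  by rewrite -ex -ey; ring.
transitivity (p%:~R * v - r%:~R * u); last by rewrite /u /v; ring.
by rewrite -ex -ey; ring.
Qed.

(** * Tilted lines *)

Definition neutral (t : R) := 0 <= t <= 1.

(* The e_i are values of f_i - 1 at points of the triangle bounded by the cuts
   at w5, w0, w1, with a = t1 - 1, c = - t5 and v = 1 - t0.  The two
   widths bound c from below and from above. *)
Lemma wedge_ineq (a c v e0 e1 e3 e4 : R) :
  0 < a -> 0 < c -> 0 <= v -> v <= 1 / 2 ->
  e1 * (1 + a - a * v) <= a * v -> e4 * (1 + c * v) <= c * (1 - v) ->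
  e0 * (1 + a - a * v) <= (1 + a) * v ->
  (1 + e3) * (a + c + a * c) <= 2 + a ->
  1 <= e1 + e4 -> 1 <= e0 + e3 -> False.
Proof.
move=> a0 c0 v0 v1 h1 h4 h0 h3 w1 w0.
have av : 0 <= a * v by apply: mulr_ge0 => //; exact: ltW.
have av2 : 0 <= a * (1 / 2 - v) by apply: mulr_ge0; [exact: ltW|lra].
(* The widths give e4 >= 1 - e1 >= num / D and 1 + e3 >= 2 - e0 >= Q / D; the first turns into c >=
   num / den, the second bounds c from above. *)
pose D := 1 + a - a * v.
pose num := 1 + a - 2 * (a * v).
pose den := (1 - v) * D - v * num.
pose Q := 2 * D - (1 + a) * v.
have D0 : 0 < D by rewrite /D; lra.
have num0 : 0 < num by rewrite /num; lra.
have Q0 : 0 < Q by rewrite /Q /D; lra.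
have cv : 0 < 1 + c * v by rewrite ltr_wpDr // mulr_ge0 // ltW.
have hc : num <= c * den.
  have e : (1 - e1) * (1 + c * v) <= c * (1 - v).
    by apply: le_trans h4; apply: ler_wpM2r; [exact: ltW|lra].
  have : (1 - e1) * D * (1 + c * v) <= c * (1 - v) * D.
    by rewrite mulrAC ler_wpM2r // ltW.
  have : num * (1 + c * v) <= (1 - e1) * D * (1 + c * v).
    by apply: ler_wpM2r; [exact: ltW|rewrite /num /D; lra].
  rewrite /den; lra.
have den0 : 0 < den by rewrite -(pmulr_rgt0 _ c0); exact: lt_le_trans hc.
have hq : Q * (a + c + a * c) <= D * (2 + a).
  have s0 : 0 < a + c + a * c by rewrite !addr_gt0 ?mulr_gt0.
  apply: (@le_trans _ _ (D * ((1 + e3) * (a + c + a * c)))); last first.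
    by apply: ler_wpM2l => //; exact: ltW.
  rewrite mulrA; apply: ler_wpM2r; first exact: ltW.
  have : D * (2 - e0) <= D * (1 + e3) by apply: ler_wpM2l; [exact: ltW|lra].
  by rewrite /Q; move: h0; rewrite -/D; lra.
have key : num * ((1 + a) * Q) <= (D * (2 + a) - a * Q) * den.
  have h : num * ((1 + a) * Q) <= c * den * ((1 + a) * Q).
    by apply: ler_wpM2r => //; apply: mulr_ge0; [lra|exact: ltW].
  apply: (le_trans h).
  rewrite [X in X <= _](_ : _ = (c * (1 + a) * Q) * den); last by ring.
  by apply: ler_wpM2r; [exact: ltW|lra].
(* With c eliminated, [key] is polynomial in a and v; the next three facts settle the coefficients
   of a^2, a^3 and a. *)
have h1' : 0 <= a ^+ 2 * ((2 - v) * (1 - 2 * v) + v ^+ 3).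
  apply: mulr_ge0; first exact: sqr_ge0.
  by apply: addr_ge0; [apply: mulr_ge0; lra|apply: exprn_ge0].
have h2' : 0 <= a ^+ 3 * ((1 - 2 * v) * (1 - v) ^+ 2).
  apply: mulr_ge0; first by apply: exprn_ge0; exact: ltW.
  by apply: mulr_ge0; [lra|exact: sqr_ge0].
have h3' : 0 < a * (1 - 2 * v ^+ 2) by apply: mulr_gt0 => //; nra.
by move: key; rewrite /den /Q /D /num; lra.
Qed.

(* Bounds on y, x + y, - x and - (x + y) under the tilted cut at w1, with
   a = t1 - 1. *)
Lemma tilt_top (a t x y : R) : 0 <= a -> y - a * x <= 1 ->
  x + t * y <= 1 -> (y - 1) * (1 + a * t) <= a * (1 - t).
Proof. by move=> a0 h1 h; have := ler_wpM2l a0 h; lra. Qed.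

Lemma tilt_sum (a t x y : R) : 0 <= a -> y - a * x <= 1 ->
  t <= 1 -> x + t * y <= 1 ->
  (x + y - 1) * (1 + a * t) <= (1 + a) * (1 - t).
Proof.
move=> a0 h1 t1 h; have a1 : 0 <= 1 + a by lra.
have := ler_wpM2l a1 h; have t1' : 0 <= 1 - t by lra.
by have := ler_wpM2l t1' h1; lra.
Qed.

Lemma tilt_left (a t x y : R) : 0 <= t -> y - a * x <= 1 ->
  - x - t * y <= 1 -> (- x - 1) * (1 + a * t) <= t * (1 - a).
Proof. by move=> h0 h1 h; have := ler_wpM2l h0 h1; lra. Qed.

Lemma tilt_low (a t x y : R) : 0 <= a -> 1 <= t -> y - a * x <= 1 ->
  - x - t * y <= 1 -> (- (x + y) - 1) * (1 + a * t) <= (t - 1) * (1 - a).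
Proof.
move=> a0 h0 h1 h; have h0' : 0 <= t - 1 by lra.
have := ler_wpM2l h0' h1; have a1 : 0 <= 1 + a by lra.
by have := ler_wpM2l a1 h; lra.
Qed.

Lemma no_wedge_half K t0 t1 t2 t3 t4 t5 :
  lattice_wide K -> hexcut K t0 t1 t2 t3 t4 t5 ->
  t5 < 0 -> 1 < t1 -> t0 <= 1 -> 1 / 2 <= t0 -> False.
Proof.
move=> wK [k0 k1 _ _ _ k5] h5 h1 h0 h0'.
have [//|x1 [y1 [x4 [y4 [p1 p4 w1]]]]] := wK 0 1.
have [//|x0 [y0 [x3 [y3 [p0 p3 w0]]]]] := wK 1 1.
have a0 : 0 <= t1 - 1 by lra.
have c0 : 0 <= - t5 by lra.
have tilt1 x y : K x y -> y - (t1 - 1) * x <= 1 by move/k1; lra.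
have E1 := tilt_top a0 (tilt1 _ _ p1) (k0 _ _ p1).
have E0 := tilt_sum a0 (tilt1 _ _ p0) h0 (k0 _ _ p0).
have E4 : (- y4 - 1) * (1 - t5 * (1 - t0)) <= - t5 * t0.
  by have := ler_wpM2l c0 (k0 _ _ p4); have := k5 _ _ p4; lra.
have E3 : - (x3 + y3) * ((t1 - 1) - t5 - (t1 - 1) * t5) <= 2 + (t1 - 1).
  have a1 : 0 <= t1 by lra.
  by have := ler_wpM2l a1 (k5 _ _ p3); have := tilt1 _ _ p3; lra.
apply: (@wedge_ineq (t1 - 1) (- t5) (1 - t0)
   (x0 + y0 - 1) (y1 - 1) (- (x3 + y3) - 1) (- y4 - 1));
   clear - h1 h5 h0 h0' E0 E1 E3 E4 w0 w1; lra.
Qed.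

Lemma no_wedge K t0 t1 t2 t3 t4 t5 :
  lattice_wide K -> hexcut K t0 t1 t2 t3 t4 t5 ->
  t5 < 0 -> 1 < t1 -> neutral t0 -> False.
Proof.
move=> wK hK h5 h1 /andP[h0 h0'].
(* The reflection fixing w0 exchanges w1 and w5 and turns t0 into 1 - t0. *)
have [h|h] := lerP (1 / 2) t0; first exact: no_wedge_half hK h5 h1 h0' h.
by apply: (no_wedge_half (lattice_wide_rot (lattice_wide_mir wK))
  (hexcut_rot (hexcut_mir hK))); lra.
Qed.

(** With a = t1 - 1, the widths force e4 to be larger than the cuts at w4 and w5 allow in
    [no_single_le]. *)
Lemma single_ineq (a t0 t3 t5 e1 e2 e4 e5 : R) :
  0 < a -> 0 <= t0 <= 1 -> 0 <= t3 <= 1 ->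
  e1 * (1 + a * t0) <= a * (1 - t0) -> e2 * (1 + a * t3) <= t3 * (1 - a) ->
  e5 <= 1 - t5 -> e5 <= t0 -> 1 <= e1 + e4 -> 1 <= e2 + e5 -> 0 <= t5 ->
  (1 + a) * t5 < e4.
Proof.
move=> a0 /andP[n0 n0'] /andP[n3 n3'] h1 h2 h5 h5' w1 w2 n5.
have at3 : 0 < 1 + a * t3.
  by apply: ltr_wpDr => //; apply: mulr_ge0 => //; exact: ltW.
have at0 : 0 < 1 + a * t0.
  by apply: ltr_wpDr => //; apply: mulr_ge0 => //; exact: ltW.
(* For a >= 1, e2 <= 0 forces e5 >= 1, hence t0 = 1, t5 = 0 and e4 >= 1. *)
have [a1|a1] := lerP 1 a.
  have e20 : e2 <= 0.
    rewrite -(pmulr_lle0 _ at3); apply: (le_trans h2).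
    by apply: mulr_ge0_le0 => //; lra.
  have t01 : t0 = 1 by lra.
  have e10 : e1 <= 0.
    by rewrite -(pmulr_lle0 _ at0); apply: (le_trans h1); rewrite t01; lra.
  by rewrite (_ : t5 = 0); lra.
(* Put z = (1 - a) / (1 + a). Then e2 <= z, so 1 - t0 <= z and t5 <= z, so e1 <= a z, and e4 >= 1 -
   a z > 1 - a >= (1 + a) t5. *)
have e2z : e2 * (1 + a) <= 1 - a.
  have [e20|e20] := lerP e2 0; first by clear - e20 a0 a1; nra.
  have g : 0 <= 1 - a - a * e2 by clear - e20 h2 n3; nra.
  by clear - g h2 n3'; nra.
have z0 : (1 - t0) * (1 + a) <= 1 - a by clear - e2z h5' w2 a0; nra.
have z5 : t5 * (1 + a) <= 1 - a by clear - e2z h5 w2 a0; nra.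
have e1z : e1 * (1 + a) <= a * (1 - a).
  have [e10|e10] := lerP e1 0; first by clear - e10 a0 a1; nra.
  have : e1 <= a * (1 - t0).
    by have := mulr_ge0 (ltW e10) (mulr_ge0 (ltW a0) n0); lra.
  by clear -z0 a0; nra.
clear - e1z z5 w1 a0 a1.
have h : (1 - e4) * (1 + a) <= a * (1 - a).
  by apply: le_trans e1z; apply: ler_wpM2r; lra.
rewrite -(ltr_pM2r (_ : 0 < 1 + a)); last by lra.
have := ler_wpM2r (_ : 0 <= 1 + a) z5; have := mulr_gt0 a0 a0; lra.
Qed.

Lemma no_single_le K t0 t1 t2 t3 t4 t5 :
  lattice_wide K -> hexcut K t0 t1 t2 t3 t4 t5 ->
  1 < t1 -> neutral t0 -> neutral t3 -> neutral t5 -> 1 - t1 <= t4 <= 1 ->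
  False.
Proof.
move=> wK [k0 k1 _ k3 k4 k5] h1 n0 n3 n5 /andP[h4 h4'].
have [//|x1 [y1 [x4 [y4 [p1 p4 w1]]]]] := wK 0 1.
have [//|x5 [y5 [x2 [y2 [p5 p2 w2]]]]] := wK 1 0.
have /andP[n0a n0b] := n0; have /andP[n3a n3b] := n3; have /andP[n5a n5b] := n5.
have a0 : 0 < t1 - 1 by lra.
have tilt1 x y : K x y -> y - (t1 - 1) * x <= 1 by move/k1; lra.
have e5l := edge_le_left n5b n0 (k5 _ _ p5) (k0 _ _ p5).
have e5r := edge_le_right n5 n0a (k5 _ _ p5) (k0 _ _ p5).
have e1 := tilt_top (ltW a0) (tilt1 _ _ p1) (k0 _ _ p1).
have e2 := tilt_left n3a (tilt1 _ _ p2) (k3 _ _ p2).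
have w14 : 1 <= y1 - 1 + (- y4 - 1) by lra.
have w25 : 1 <= - x2 - 1 + (x5 - 1) by lra.
have := single_ineq a0 n0 n3 e1 e2 e5l e5r w14 w25 n5a.
have g4 := k4 _ _ p4; have g5 := k5 _ _ p4.
have [h|h] := lerP 0 t4.
  have n4 : 0 <= t4 <= 1 by rewrite h.
  have := @edge_le_right t4 t5 (- y4) (x4 + y4) n4 n5a.
  have := mulr_ge0 (ltW a0) n5a.
  clear - g4 g5; lra.
(* For t4 < 0, the weights t5 and 1 - t4 on the cuts at w4 and w5 eliminate x4. *)
have f4 := ler_wpM2l n5a g4.
have c1 : 0 <= 1 - t4 by lra.
have f5 := ler_wpM2l c1 g5.
have c5 : 0 <= - t4 * (1 - t5) by apply: mulr_ge0; lra.
have : (- y4 - 1) * (1 + - t4 * (1 - t5)) <= (1 - t4) * t5.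
  by clear - f4 f5; lra.
have : 0 <= (t4 - (1 - t1)) * t5 by apply: mulr_ge0 => //; lra.
clear - c5 n5a a0 => hh e4 lt4.
have e40 : 0 < - y4 - 1 by apply: le_lt_trans lt4; apply: mulr_ge0 => //; lra.
have := mulr_ge0 (ltW e40) c5; lra.
Qed.

Lemma no_single K t0 t1 t2 t3 t4 t5 :
  lattice_wide K -> hexcut K t0 t1 t2 t3 t4 t5 ->
  1 < t1 -> neutral t0 -> neutral t2 -> neutral t3 -> t4 <= 1 -> neutral t5 ->
  False.
Proof.
move=> wK hK h1 n0 n2 n3 h4 n5.
(* The reflection exchanging w1 and w4 lets -t4 be at most t1 - 1. *)
have [h|h] := lerP (1 - t1) t4.
  by apply: (no_single_le wK hK h1 n0 n3 n5); rewrite h.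
have w2 := lattice_wide_rot (lattice_wide_rot wK).
have w4 := lattice_wide_rot (lattice_wide_rot w2).
have k2 := hexcut_rot (hexcut_rot hK).
have k4 := hexcut_rot (hexcut_rot k2).
apply: (no_single_le (lattice_wide_mir w4) (hexcut_mir k4));
  rewrite /neutral in n0 n2 n3 n5 *; lra.
Qed.

(** Once a, b < 1, the bounds hold without denominators and the widths add up to 2 <= (a + b) + (s +
    t) (1 - a - b). The right side is affine in s + t, with values a + b and 2 - (a + b) at the ends
    0 and 2, both below 2. *)
Lemma opposite_ineq (a b s t e1 e2 e4 e5 : R) : 0 < a -> 0 < b ->
  0 <= s <= 1 -> 0 <= t <= 1 ->
  e1 * (1 + a * s) <= a * (1 - s) -> e2 * (1 + a * t) <= t * (1 - a) ->
  e4 * (1 + b * t) <= b * (1 - t) -> e5 * (1 + b * s) <= s * (1 - b) ->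
  1 <= e1 + e4 -> 1 <= e2 + e5 -> False.
Proof.
move=> a0 b0 /andP[s0 s1] /andP[t0 t1] h1 h2 h4 h5 w1 w2.
have bnd (c u e f : R) : 0 <= c -> 0 <= u -> 0 <= f ->
    e * (1 + c * u) <= f -> e <= f.
  move=> c0 u0 f0 h; have [|e0] := lerP e 0; first by move/le_trans; exact.
  have := mulr_ge0 (ltW e0) (mulr_ge0 c0 u0); lra.
have pos (c u e f : R) : 0 < c -> 0 <= u -> f <= 0 ->
    e * (1 + c * u) <= f -> e <= 0.
  move=> c0 u0 f0 h; rewrite -(pmulr_lle0 _ (_ : 0 < 1 + c * u)).
    exact: le_trans h f0.
  by apply: ltr_wpDr => //; apply: mulr_ge0 => //; exact: ltW.
(* If b >= 1, then e5 <= 0, so e2 >= 1, against e2 <= t (1 - a). *)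
have b1 : b < 1.
  rewrite ltNge; apply/negP => b1.
  have e50 : e5 <= 0 by apply: pos h5 => //; apply: mulr_ge0_le0; lra.
  have [a1|a1] := lerP 1 a.
    have : e2 <= 0 by apply: pos h2 => //; apply: mulr_ge0_le0; lra.
    lra.
  have : e2 <= t * (1 - a).
    by apply: bnd h2 => //; [exact: ltW|apply: mulr_ge0; lra].
  clear - t1 a0 a1 e50 w2 t0; nra.
have a1 : a < 1.
  rewrite ltNge; apply/negP => a1.
  have : e2 <= 0 by apply: pos h2 => //; apply: mulr_ge0_le0; lra.
  have : e5 <= s * (1 - b).
    by apply: bnd h5 => //; [exact: ltW|apply: mulr_ge0; lra].
  clear - s1 s0 b0 b1 w2; nra.
have b1' : 0 <= 1 - b by lra.
have a1' : 0 <= 1 - a by lra.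
have s1' : 0 <= 1 - s by lra.
have t1' : 0 <= 1 - t by lra.
have := bnd _ _ _ _ (ltW a0) s0 (mulr_ge0 (ltW a0) s1') h1.
have := bnd _ _ _ _ (ltW a0) t0 (mulr_ge0 t0 a1') h2.
have := bnd _ _ _ _ (ltW b0) t0 (mulr_ge0 (ltW b0) t1') h4.
have := bnd _ _ _ _ (ltW b0) s0 (mulr_ge0 s0 b1') h5.
clear - a0 b0 a1 b1 s0 s1 t0 t1 w1 w2 => h5 h4 h2 h1.
have [ab|ab] := lerP 1 (a + b).
  have := mulr_ge0 s0 (_ : 0 <= a + b - 1).
  have := mulr_ge0 t0 (_ : 0 <= a + b - 1).
  lra.
have := mulr_ge0 (_ : 0 <= 1 - s) (_ : 0 <= 1 - (a + b)).
have := mulr_ge0 (_ : 0 <= 1 - t) (_ : 0 <= 1 - (a + b)).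
lra.
Qed.

Lemma no_opposite K t0 t1 t2 t3 t4 t5 :
  lattice_wide K -> hexcut K t0 t1 t2 t3 t4 t5 ->
  1 < t1 -> neutral t0 -> neutral t3 -> 1 < t4 -> False.
Proof.
move=> wK [k0 k1 _ k3 k4 _] h1 n0 n3 h4.
have [//|x1 [y1 [x4 [y4 [p1 p4 w1]]]]] := wK 0 1.
have [//|x5 [y5 [x2 [y2 [p5 p2 w2]]]]] := wK 1 0.
have /andP[n0a n0b] := n0; have /andP[n3a n3b] := n3.
have a0 : 0 < t1 - 1 by lra.
have b0 : 0 < t4 - 1 by lra.
have tilt1 x y : K x y -> y - (t1 - 1) * x <= 1 by move/k1; lra.
(* The half-turn gives the cuts at w4, w0, w3 the shape of those at w1, w3, w0, so the same bounds
   apply. *)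
have tilt4 x y : K x y -> - y - (t4 - 1) * (- x) <= 1 by move/k4; lra.
have k0' x y : K x y -> - - x - t0 * - y <= 1 by move/k0; lra.
have k3' x y : K x y -> - x + t3 * - y <= 1 by move/k3; lra.
apply: (opposite_ineq a0 b0 n0 n3
  (tilt_top (ltW a0) (tilt1 _ _ p1) (k0 _ _ p1))
  (tilt_left n3a (tilt1 _ _ p2) (k3 _ _ p2))
  (tilt_top (ltW b0) (tilt4 _ _ p4) (k3' _ _ p4))
  (tilt_left n0a (tilt4 _ _ p5) (k0' _ _ p5))); lra.
Qed.

(** The second width gives 1 - s <= e2 and u <= e2, so e1 <= a e2 and e4 <= (1 - b) e2. The first
    then asks for (1 + a - b) e2 >= 1, which is too much for the bound on e2. *)
Lemma pair_ineq (a b s u e1 e2 e4 e5 : R) : 0 < a -> 0 < b ->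
  0 <= s <= 1 -> 0 <= u <= 1 ->
  e1 * (1 + a * s) <= a * (1 - s) ->
  e2 * (1 + a * (1 + b)) <= (1 + b) * (1 - a) ->
  e4 * (1 + b * u) <= u * (1 - b) -> e5 <= 1 - u -> e5 <= s ->
  1 <= e1 + e4 -> 1 <= e2 + e5 -> False.
Proof.
move=> a0 b0 /andP[s0 s1] /andP[u0 u1] h1 h2 h4 h5 h5' w1 w2.
have as0 : 0 <= a * s by apply: mulr_ge0 => //; exact: ltW.
have bu0 : 0 <= b * u by apply: mulr_ge0 => //; exact: ltW.
have ab0 : 0 < a * b by apply: mulr_gt0.
have sz : 1 - s <= e2 by lra.
have uz : u <= e2 by lra.
have z0 : 0 <= e2 by lra.
have e1z : e1 <= a * e2.
  have [e10|e10] := lerP e1 0.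
    by apply: (le_trans e10); apply: mulr_ge0 => //; exact: ltW.
  have := ler_wpM2l (ltW a0) sz; have := mulr_ge0 (ltW e10) as0; lra.
have bu1 : 0 < 1 + b * u by lra.
have p2 : 0 < 1 + a * (1 + b) by lra.
have b1 : b < 1.
  rewrite ltNge; apply/negP => b1.
  have e40 : e4 <= 0.
    by rewrite -(pmulr_lle0 _ bu1); apply: (le_trans h4); apply: mulr_ge0_le0; lra.
  have a1 : a < 1.
    rewrite ltNge; apply/negP => a1.
    have : e2 <= 0.
      by rewrite -(pmulr_lle0 _ p2); apply: (le_trans h2); apply: mulr_ge0_le0; lra.
    by move=> e20; have := mulr_ge0_le0 (ltW a0) e20; lra.
  have := ler_wpM2r as0 (_ : 1 <= e1); lra.
have e4z : e4 <= u * (1 - b).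
  have [e40|e40] := lerP e4 0.
    by apply: (le_trans e40); apply: mulr_ge0 => //; lra.
  by have := mulr_ge0 (ltW e40) bu0; lra.
have e4z' : e4 <= e2 * (1 - b).
  by apply: (le_trans e4z); apply: ler_wpM2r; lra.
have k0 : 0 < 1 + a - b by lra.
have := ler_wpM2r (ltW k0) h2.
have : 1 * (1 + a * (1 + b)) <= (a * e2 + e2 * (1 - b)) * (1 + a * (1 + b)).
  by apply: ler_wpM2r; lra.
(* (1 + a - b) (1 + b) (1 - a) = 1 - (a - b)^2 - a b (1 + a - b) < 1. *)
have := sqr_ge0 (a - b); have := mulr_gt0 ab0 k0; lra.
Qed.

Lemma no_pair K t0 t1 t2 t3 t4 t5 :
  lattice_wide K -> hexcut K t0 t1 t2 t3 t4 t5 ->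
  1 < t1 -> 1 < t3 -> neutral t0 -> neutral t5 -> False.
Proof.
move=> wK [k0 k1 _ k3 _ k5] h1 h3 n0 n5.
have [//|x1 [y1 [x4 [y4 [p1 p4 w1]]]]] := wK 0 1.
have [//|x5 [y5 [x2 [y2 [p5 p2 w2]]]]] := wK 1 0.
have /andP[n0a n0b] := n0; have /andP[n5a n5b] := n5.
have a0 : 0 < t1 - 1 by lra.
have b0 : 0 < t3 - 1 by lra.
have t30 : 0 <= t3 by lra.
have tilt1 x y : K x y -> y - (t1 - 1) * x <= 1 by move/k1; lra.
have tilt3 x y : K x y -> - x - (t3 - 1) * y - y <= 1 by move/k3; lra.
have e5l := edge_le_left n5b n0 (k5 _ _ p5) (k0 _ _ p5).
have e5r := edge_le_right n5 n0a (k5 _ _ p5) (k0 _ _ p5).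
have e1 := tilt_top (ltW a0) (tilt1 _ _ p1) (k0 _ _ p1).
have e2 := tilt_left t30 (tilt1 _ _ p2) (k3 _ _ p2).
have e4 : (- y4 - 1) * (1 + (t3 - 1) * t5) <= t5 * (1 - (t3 - 1)).
  have := @tilt_left (t3 - 1) t5 y4 (- (x4 + y4)) n5a.
  by have := k3 _ _ p4; have := k5 _ _ p4; lra.
apply: (pair_ineq a0 b0 n0 n5 e1 _ e4 e5l e5r _ (e2 := - x2 - 1)); [|lra|lra].
by rewrite (_ : 1 + (t3 - 1) = t3); [exact: e2|ring].
Qed.

(** Here a, b, c are the tilts at w1, w3, w5. For a < 1, the bounds on e2 and e5 contradict their
    width once c is replaced by its maximum a. *)
Lemma triple_ineq (a b c e0 e2 e3 e5 : R) : 0 < a -> 0 < b -> 0 < c ->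
  b <= a -> c <= a ->
  e0 * (1 + c * (1 + a)) <= (1 + a) * (1 - c) ->
  e2 * (1 + a * (1 + b)) <= (1 + b) * (1 - a) ->
  e3 * (1 + a * (1 + b)) <= b * (1 - a) ->
  e5 * (1 + b * (1 + c)) <= c * (1 - b) ->
  1 <= e0 + e3 -> 1 <= e2 + e5 -> False.
Proof.
move=> a0 b0 c0 ba ca h0 h2 h3 h5 w0 w2.
have ab0 : 0 < a * b by apply: mulr_gt0.
have bc0 : 0 < b * c by apply: mulr_gt0.
have ca0 : 0 < c * a by apply: mulr_gt0.
have p2 : 0 < 1 + a * (1 + b) by lra.
have p5 : 0 < 1 + b * (1 + c) by lra.
have p0 : 0 < 1 + c * (1 + a) by lra.
have [a1|a1] := lerP 1 a.
  have e20 : e2 <= 0.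
    by rewrite -(pmulr_lle0 _ p2); apply: (le_trans h2); apply: mulr_ge0_le0; lra.
  have e30 : e3 <= 0.
    by rewrite -(pmulr_lle0 _ p2); apply: (le_trans h3); apply: mulr_ge0_le0; lra.
  have := ler_wpM2r (ltW p5) (_ : 1 <= e5).
  have := ler_wpM2r (ltW p0) (_ : 1 <= e0).
  clear - h0 h5 e20 e30 w0 w2 bc0 ca0 a1 b0 c0 ab0 => A B.
  have {}A := A ltac:(lra); have {}B := B ltac:(lra).
  have c1 : 1 < c by lra.
  have := mulr_gt0 (_ : 0 < c - 1) (_ : 0 < a); lra.
(* [n] is 1 + a (1 + b) minus the right side of [h2], the numerator of the lower bound on 1 - e2. *)
pose n := 2 * a + 2 * (a * b) - b.
have n0 : 0 < n by rewrite /n; lra.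
have s1 : n <= (1 - e2) * (1 + a * (1 + b)) by rewrite /n; lra.
have s2 : (1 - e2) * (1 + b * (1 + c)) <= c * (1 - b).
  by apply: le_trans h5; apply: ler_wpM2r; [exact: ltW|lra].
have s3 : n * (1 + b * (1 + c)) <= c * (1 - b) * (1 + a * (1 + b)).
  apply: (@le_trans _ _ ((1 - e2) * (1 + a * (1 + b)) * (1 + b * (1 + c)))).
    by apply: ler_wpM2r => //; exact: ltW.
  by rewrite mulrAC; apply: ler_wpM2r => //; exact: ltW.
have s4 : c * (1 - b) * (1 + a * (1 + b)) <= a * (1 - b) * (1 + a * (1 + b)).
  by apply: ler_wpM2r; [exact: ltW|apply: ler_wpM2r; lra].
have s5 : n * (1 + b) <= n * (1 + b * (1 + c)).
  by apply: ler_wpM2l; [exact: ltW|lra].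
have s6 : 0 <= (a - b) * (1 - (a - b)) by apply: mulr_ge0; lra.
have := mulr_gt0 ab0 b0; have := mulr_gt0 ab0 ab0.
move: (le_trans s5 (le_trans s3 s4)); rewrite /n; lra.
Qed.

Lemma no_triple_max K t0 t1 t2 t3 t4 t5 :
  lattice_wide K -> hexcut K t0 t1 t2 t3 t4 t5 ->
  1 < t1 -> 1 < t3 -> 1 < t5 -> t3 <= t1 -> t5 <= t1 -> False.
Proof.
move=> wK [_ k1 _ k3 _ k5] h1 h3 h5 h31 h51.
have [//|x0 [y0 [x3 [y3 [p0 p3 w0]]]]] := wK 1 1.
have [//|x5 [y5 [x2 [y2 [p5 p2 w2]]]]] := wK 1 0.
have a0 : 0 < t1 - 1 by lra.
have b0 : 0 < t3 - 1 by lra.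
have c0 : 0 < t5 - 1 by lra.
have t10 : 0 <= t1 by lra. have t30 : 0 <= t3 by lra.
have tilt1 x y : K x y -> y - (t1 - 1) * x <= 1 by move/k1; lra.
have e2 := tilt_left t30 (tilt1 _ _ p2) (k3 _ _ p2).
have e3 := tilt_low (ltW a0) (ltW h3) (tilt1 _ _ p3) (k3 _ _ p3).
have e0 : (x0 + y0 - 1) * (1 + (t5 - 1) * t1) <= t1 * (1 - (t5 - 1)).
  have := @tilt_left (t5 - 1) t1 (- (x0 + y0)) x0 t10.
  by have := k5 _ _ p0; have := k1 _ _ p0; lra.
have e5 : (x5 - 1) * (1 + (t3 - 1) * t5) <= (t5 - 1) * (1 - (t3 - 1)).
  have := @tilt_low (t3 - 1) t5 y5 (- (x5 + y5)) (ltW b0) (ltW h5).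
  by have := k3 _ _ p5; have := k5 _ _ p5; lra.
by apply: (@triple_ineq (t1 - 1) (t3 - 1) (t5 - 1) (x0 + y0 - 1) (- x2 - 1)
  (- (x3 + y3) - 1) (x5 - 1)); rewrite ?(addrC 1 (_ - 1)) ?subrK //; lra.
Qed.

(** A rotation by two steps permutes w1, w3, w5 cyclically and brings the largest tilt to w1. *)
Lemma no_triple K t0 t1 t2 t3 t4 t5 :
  lattice_wide K -> hexcut K t0 t1 t2 t3 t4 t5 ->
  1 < t1 -> 1 < t3 -> 1 < t5 -> False.
Proof.
move=> wK hK h1 h3 h5.
have w2 := lattice_wide_rot (lattice_wide_rot wK).
have w4 := lattice_wide_rot (lattice_wide_rot w2).
have k2 := hexcut_rot (hexcut_rot hK); have k4 := hexcut_rot (hexcut_rot k2).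
have [h31|h31] := lerP t3 t1; have [h51|h51] := lerP t5 t1.
- exact: no_triple_max wK hK _ _ _ _ _.
- by apply: no_triple_max w4 k4 _ _ _ _ _ => //; lra.
- by apply: no_triple_max w2 k2 _ _ _ _ _ => //; lra.
have [h35|h35] := lerP t3 t5.
- by apply: no_triple_max w4 k4 _ _ _ _ _ => //; lra.
by apply: no_triple_max w2 k2 _ _ _ _ _ => //; lra.
Qed.

(** The hypotheses have the factors a and b. Divided by them and added, with a b <= (a + b)^2 / 4,
    they give a cubic in a + b whose only real root is 2. *)
Lemma strip_ineq (a b : R) : 0 <= a <= 1 -> 0 <= b <= 1 ->
  (2 - a) * (1 - b) <= (1 - a * (2 - b)) * (2 - b * (2 - a)) ->
  (2 - b) * (1 - a) <= (1 - b * (2 - a)) * (2 - a * (2 - b)) ->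
  (a = 0 /\ b = 0) \/ (a = 1 /\ b = 1).
Proof.
move=> /andP[a0 a1] /andP[b0 b1] f1 f2.
have g1 : 0 <= a * (6 * b - 3 - 2 * b ^+ 2 - 2 * (a * b) + a * b ^+ 2) by lra.
have g2 : 0 <= b * (6 * a - 3 - 2 * a ^+ 2 - 2 * (a * b) + a ^+ 2 * b) by lra.
clear f1 f2.
have [az|az] := eqVneq a 0.
  left; split => //; rewrite az in g2; apply/eqP; rewrite eq_le b0 andbT; lra.
have [bz|bz] := eqVneq b 0.
  left; split => //; rewrite bz in g1; apply/eqP; rewrite eq_le a0 andbT; lra.
have {}g1 : 0 <= 6 * b - 3 - 2 * b ^+ 2 - 2 * (a * b) + a * b ^+ 2.
  by rewrite -(pmulr_rge0 _ (_ : 0 < a)) // lt_neqAle eq_sym az.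
have {}g2 : 0 <= 6 * a - 3 - 2 * a ^+ 2 - 2 * (a * b) + a ^+ 2 * b.
  by rewrite -(pmulr_rge0 _ (_ : 0 < b)) // lt_neqAle eq_sym bz.
right.
have h : 0 <= (a + b - 2) * ((a + b) ^+ 2 / 4 - 3 / 2 * (a + b) + 3).
  have := mulr_ge0 (addr_ge0 a0 b0) (sqr_ge0 (a - b)); lra.
have q : 0 < (a + b) ^+ 2 / 4 - 3 / 2 * (a + b) + 3.
  have := sqr_ge0 (a + b - 3); lra.
have : 0 <= a + b - 2 by rewrite -(pmulr_lge0 _ q).
by split; lra.
Qed.

(** Here p and -q are points of K between the lines of slope parameters k1 and k3. Multiplying the
    bounds at p and q eliminates k1 and k3, and the widths reduce the rest to [strip_ineq]. *)
Lemma strip_extremal (a b u k1 k3 p1 p2 q1 q2 e4 e5 : R) :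
  0 < k1 -> 0 < k3 -> 0 <= a <= 1 -> 0 <= b <= 1 ->
  p1 + a * p2 <= 1 -> b * q1 + q2 <= 1 ->
  p2 - k1 * p1 <= 1 -> k1 * q1 - q2 <= 1 ->
  k3 * p2 - p1 <= 1 -> q1 - k3 * q2 <= 1 ->
  e4 <= b -> e4 <= u -> e5 <= a -> e5 <= 1 - u ->
  2 <= p2 + e4 -> 2 <= q1 + e5 ->
  [/\ a = 0, b = 0, k1 = 1, p1 = 1 /\ p2 = 2 & q1 = 2 /\ q2 = 1].
Proof.
move=> k10 k30 ha hb l0 l4 P1 Q1 P3 Q3 e4b e4u e5a e5u w1 w2.
have /andP[a0 a1] := ha; have /andP[b0 b1] := hb.
have p21 : 1 <= p2 by lra.
have q11 : 1 <= q1 by lra.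
have p10 : 0 <= p1 by rewrite -(pmulr_rge0 _ k10); lra.
have q20 : 0 <= q2 by rewrite -(pmulr_rge0 _ k30); lra.
have I1 : q1 * (p2 - 1) <= p1 * (1 + q2).
  have := ler_wpM2l (_ : 0 <= q1) (_ : p2 - 1 <= k1 * p1).
  have := ler_wpM2l p10 (_ : k1 * q1 <= 1 + q2); lra.
have I2 : p2 * (q1 - 1) <= q2 * (1 + p1).
  have := ler_wpM2l (_ : 0 <= p2) (_ : q1 - 1 <= k3 * q2).
  have := ler_wpM2l q20 (_ : k3 * p2 <= 1 + p1); lra.
clear P3 Q3 k30 k10.
have ap : a * (2 - b) <= a * p2 by apply: ler_wpM2l => //; lra.
have bq : b * (2 - a) <= b * q1 by apply: ler_wpM2l => //; lra.
have F1 : (2 - a) * (1 - b) <= (1 - a * (2 - b)) * (2 - b * (2 - a)).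
  apply: (@le_trans _ _ (q1 * (p2 - 1))); first by apply: ler_pM; lra.
  by apply: (le_trans I1); apply: ler_pM; lra.
have F2 : (2 - b) * (1 - a) <= (1 - b * (2 - a)) * (2 - a * (2 - b)).
  apply: (@le_trans _ _ (p2 * (q1 - 1))); first by apply: ler_pM; lra.
  by apply: (le_trans I2); apply: ler_pM; lra.
have [[az bz]|[az bz]] := strip_ineq ha hb F1 F2; last first.
  (* For a = b = 1 both e4 and e5 would be at least 1, against e4 <= u and e5 <= 1 - u. *)
  by exfalso; rewrite az bz in l0 l4; lra.
clear F1 F2 I2 ap bq hb a0 a1 b0 b1 e4u e5u.
rewrite az bz in l0 l4 e4b e5a *.
have p22 : 2 <= p2 by lra.
have q12 : 2 <= q1 by lra.
have r1 : p1 * (1 + q2) <= 1 * 2 by apply: ler_pM; lra.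
have r2 : 2 * (p2 - 1) <= q1 * (p2 - 1) by apply: ler_wpM2r; lra.
have p2e : p2 = 2 by lra.
rewrite p2e in r2 I1 *.
have q1e : q1 = 2 by lra.
have r3 : p1 * (1 + q2) <= p1 * 2 by apply: ler_wpM2l; lra.
have p1e : p1 = 1 by lra.
have q2e : q2 = 1 by rewrite p1e in I1; lra.
by split => //; rewrite p1e p2e q1e q2e in P1 Q1; lra.
Qed.

(* The case of the triangle (1, 2), (-2, -1), (1, -1): its cuts at w1 and w3
   both follow the edge y = x + 1. *)
Lemma strip_triangle K t0 t1 t2 t3 t4 t5 :
  convex2 K -> lattice_wide K -> hexcut K t0 t1 t2 t3 t4 t5 ->
  1 < t1 -> t3 < 0 -> neutral t0 -> neutral t4 -> neutral t5 ->
  unimod_triangle K.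
Proof.
move=> cK wK [k0 k1 _ k3 k4 k5] h1 h3 n0 n4 n5.
have [//|x1 [y1 [x4 [y4 [p1 p4 w1]]]]] := wK 0 1.
have [//|x5 [y5 [x2 [y2 [p5 p2 w2]]]]] := wK 1 0.
have [//|x6 [y6 [x7 [y7 [p6 p7 w6]]]]] := wK 1 (-1).
have /andP[n0a n0b] := n0; have /andP[n5a n5b] := n5; have /andP[n4a n4b] := n4.
have e5l := edge_le_left n5b n0 (k5 _ _ p5) (k0 _ _ p5).
have e5r := edge_le_right n5 n0a (k5 _ _ p5) (k0 _ _ p5).
have g4 := k4 _ _ p4; have g5 := k5 _ _ p4.
have e4l : - y4 - 1 <= 1 - t4.
  by apply: (@edge_le_left t4 t5 _ (x4 + y4)) => //; lra.
have e4r : - y4 - 1 <= t5.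
  by apply: (@edge_le_right t4 t5 _ (x4 + y4)) => //; lra.
have a0 : 0 < t1 - 1 by lra.
have c0 : 0 < - t3 by lra.
have n4' : 0 <= 1 - t4 <= 1 by apply/andP; split; lra.
have i0 := k0 _ _ p1; have i1 := k1 _ _ p1; have i3 := k3 _ _ p1.
have j4 := k4 _ _ p2; have j1 := k1 _ _ p2; have j3 := k3 _ _ p2.
clear - cK k0 k1 k4 p1 p2 p6 p7 w1 w2 w6 a0 c0 n0 n4' e4l e4r e5l e5r
  i0 i1 i3 j1 j3 j4.
have [] := @strip_extremal t0 (1 - t4) t5 (t1 - 1) (- t3) x1 y1 (- x2) (- y2)
  (- y4 - 1) (x5 - 1) a0 c0 n0 n4'; try lra.
move=> t00 t41 t12 [x11 y12] [x22 y21].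
have {}t12 : t1 = 2 by lra. have {}t41 : t4 = 1 by lra.
rewrite t12 t41 t00 in k0 k1 k4.
(* The cuts are now x <= 1, y <= x + 1 and y >= -1; the width along (1, -1) forces the third vertex
   (1, -1). *)
have := k0 _ _ p6; have := k4 _ _ p6; have := k1 _ _ p7 => m7 m4 m0.
have x6e : x6 = 1 by lra. have y6e : y6 = -1 by lra.
clear - cK p6 p2 p1 k0 k1 k4 x11 y12 x22 y21 x6e y6e.
apply: (triangle_of_vertices cK p6 p2 p1 (p := -1) (q := 0) (r := 0) (s := 1));
  rewrite ?rmorphN1 ?rmorph1 ?rmorph0; try lra.
by move=> x y p; have := k0 _ _ p; have := k4 _ _ p; have := k1 _ _ p;
  split; lra.
Qed.

Lemma neutral_triangle K t0 t1 t2 t3 t4 t5 :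
  convex2 K -> lattice_wide K -> hexcut K t0 t1 t2 t3 t4 t5 ->
  neutral t0 -> neutral t1 -> neutral t2 ->
  neutral t3 -> neutral t4 -> neutral t5 -> unimod_triangle K.
Proof.
move=> cK wK [k0 k1 k2 k3 k4 k5] n0 n1 n2 n3 n4 n5.
have [//|x1 [y1 [x4 [y4 [p1 p4 w1]]]]] := wK 0 1.
have [//|x0 [y0 [x3 [y3 [p0 p3 w0]]]]] := wK 1 1.
have [//|x5 [y5 [x2 [y2 [p5 p2 w2]]]]] := wK 1 0.
have bnd s t x y : neutral s -> neutral t ->
  s * x - (1 - s) * y <= 1 -> x + t * y <= 1 -> x - 1 <= 1 - s /\ x - 1 <= t.
  move=> ns nt h h'; have /andP[s0 s1] := ns; have /andP[u0 u1] := nt.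
  by split; [exact: edge_le_left h h'|exact: edge_le_right h h'].
have [a0 b0] : x0 + y0 - 1 <= 1 - t0 /\ x0 + y0 - 1 <= t1.
  by apply: (@bnd _ _ _ (- x0)) => //;
    have := k0 _ _ p0; have := k1 _ _ p0; lra.
have [a1 b1] : y1 - 1 <= 1 - t1 /\ y1 - 1 <= t2.
  by apply: (@bnd _ _ _ (- (x1 + y1))) => //;
    have := k1 _ _ p1; have := k2 _ _ p1; lra.
have [a2 b2] : - x2 - 1 <= 1 - t2 /\ - x2 - 1 <= t3.
  by apply: (@bnd _ _ _ (- y2)) => //;
    have := k2 _ _ p2; have := k3 _ _ p2; lra.
have [a3 b3] : - (x3 + y3) - 1 <= 1 - t3 /\ - (x3 + y3) - 1 <= t4.
  by apply: (@bnd _ _ _ x3) => //; have := k3 _ _ p3; have := k4 _ _ p3; lra.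
have [a4 b4] : - y4 - 1 <= 1 - t4 /\ - y4 - 1 <= t5.
  by apply: (@bnd _ _ _ (x4 + y4)) => //;
    have := k4 _ _ p4; have := k5 _ _ p4; lra.
have [a5 b5] : x5 - 1 <= 1 - t5 /\ x5 - 1 <= t0.
  by apply: (@bnd _ _ _ y5) => //; have := k5 _ _ p5; have := k0 _ _ p5; lra.
(* The equalities leave t0 free; under them this sharper bound reads t0 (1 - t0)^2 <= 0. *)
have m0 : (x0 + y0 - 1) * (1 - t0 * (1 - t1)) <= (1 - t0) * t1.
  move: n0 n1 => /andP[_ n0] /andP[n1 _]; apply: (edge_le_mul (y := - x0)) => //.
    by have := k0 _ _ p0; lra.
  by have := k1 _ _ p0; lra.
have [e0 e1 e2 e3 e4] :
  [/\ t1 = 1 - t0, t2 = t0, t3 = 1 - t0, t4 = t0 & t5 = 1 - t0].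
  by clear - a0 b0 a1 b1 a2 b2 a3 b3 a4 b4 a5 b5 w0 w1 w2; split; lra.
have [d0 d1 d2] : [/\ x0 + y0 = 2 - t0, y1 = 1 + t0 & x2 = t0 - 2].
  by clear - a0 b0 a1 b1 a2 b2 a3 b3 a4 b4 a5 b5 w0 w1 w2; split; lra.
have [d3 d4 d5] : [/\ x3 + y3 = - 1 - t0, y4 = t0 - 2 & x5 = 1 + t0].
  by clear - a0 b0 a1 b1 a2 b2 a3 b3 a4 b4 a5 b5 w0 w1 w2; split; lra.
clear a0 b0 a1 b1 a2 b2 a3 b3 a4 b4 a5 b5 w0 w1 w2.
rewrite d0 e0 in m0.
rewrite e0 e1 e2 e3 e4 in k1 k2 k3 k4 k5.
have /andP[t00 t01] := n0.
have : t0 * (1 - t0) ^+ 2 == 0.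
  rewrite eq_le; apply/andP; split; first by clear - m0; lra.
  by apply: mulr_ge0 => //; exact: sqr_ge0.
rewrite mulf_eq0 sqrf_eq0 subr_eq0 => /orP[/eqP z|/eqP z].
  rewrite z in k0 k1 k2 k3 k4 k5 d0 d1 d2 d3 d4 d5.
  have := k0 _ _ p0; have := k1 _ _ p0; have := k2 _ _ p2; have := k3 _ _ p2.
  have := k4 _ _ p4; have := k5 _ _ p4 => u1 u2 u3 u4 u5 u6.
  clear - cK p0 p2 p4 k0 k1 k3 d0 d2 d4 u1 u2 u3 u4 u5 u6.
  apply: (triangle_of_vertices cK p0 p2 p4 (p := -1) (q := 0) (r := 0) (s := -1));
    rewrite ?rmorphN1 ?rmorph1 ?rmorph0; try lra.
  by move=> x y p; have := k0 _ _ p; have := k1 _ _ p; have := k3 _ _ p;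
    split; lra.
rewrite -z in k0 k1 k2 k3 k4 k5 d0 d1 d2 d3 d4 d5.
have := k1 _ _ p1; have := k2 _ _ p1; have := k3 _ _ p3; have := k4 _ _ p3.
have := k5 _ _ p5; have := k0 _ _ p5 => u1 u2 u3 u4 u5 u6.
clear - cK p3 p5 p1 k0 k3 k4 d1 d3 d5 u1 u2 u3 u4 u5 u6.
apply: (triangle_of_vertices cK p3 p5 p1 (p := 1) (q := 0) (r := 0) (s := 1));
  rewrite ?rmorphN1 ?rmorph1 ?rmorph0; try lra.
by move=> x y p; have := k0 _ _ p; have := k3 _ _ p; have := k4 _ _ p;
  split; lra.
Qed.

(** * Hexagons without adjacent tilted lines *)

Record hexagon K t0 t1 t2 t3 t4 t5 : Prop := Hexagon {
  hexagon_cut : hexcut K t0 t1 t2 t3 t4 t5 ;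
  adj01 : neutral t0 \/ neutral t1 ;
  adj12 : neutral t1 \/ neutral t2 ;
  adj23 : neutral t2 \/ neutral t3 ;
  adj34 : neutral t3 \/ neutral t4 ;
  adj45 : neutral t4 \/ neutral t5 ;
  adj50 : neutral t5 \/ neutral t0 }.

Lemma hexagon_rot K t0 t1 t2 t3 t4 t5 :
  hexagon K t0 t1 t2 t3 t4 t5 -> hexagon (hex_rot K) t1 t2 t3 t4 t5 t0.
Proof. by case=> /hexcut_rot h *; split. Qed.

Lemma neutralN (t : R) : neutral (1 - t) = neutral t.
Proof. by rewrite /neutral subr_ge0 lerBlDr lerDl andbC. Qed.

Lemma hexagon_mir K t0 t1 t2 t3 t4 t5 :
  hexagon K t0 t1 t2 t3 t4 t5 ->
  hexagon (hex_mir K) (1 - t1) (1 - t0) (1 - t5) (1 - t4) (1 - t3) (1 - t2).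
Proof.
by case=> /hexcut_mir h a b c d e f; split => //; rewrite !neutralN or_comm.
Qed.

Lemma neutralP (t : R) : [\/ neutral t, t < 0 | 1 < t].
Proof.
have [t0|t0] := ltrP t 0; first by constructor 2.
have [t1|t1] := ltrP 1 t; first by constructor 3.
by constructor 1; rewrite /neutral t0.
Qed.

Lemma neutral_gt1 (t : R) : 1 < t -> ~ neutral t.
Proof. by move=> t1 /andP[_]; rewrite leNgt t1. Qed.

Lemma neutral_lt0 (t : R) : t < 0 -> ~ neutral t.
Proof. by move=> t1 /andP[]; rewrite leNgt t1. Qed.

(** With w1 tilted, w0 and w2 are neutral, so the cases run over w3, w4, w5. Only t3 < 0 with w5
    neutral survives. *)
Lemma tilted_hexagon_triangle K t0 t1 t2 t3 t4 t5 :
  convex2 K -> lattice_wide K -> hexagon K t0 t1 t2 t3 t4 t5 -> 1 < t1 ->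
  unimod_triangle K.
Proof.
move=> cK wK [hK a01 a12 a23 a34 a45 a50] h1.
have n1 := neutral_gt1 h1.
have n0 : neutral t0 by case: a01.
have n2 : neutral t2 by case: a12.
(* Four rotations bring w5 to the place of w1, for the cases with t5 > 1. *)
have w4 : lattice_wide (iter 4 hex_rot K) by do 4!apply: lattice_wide_rot.
have k4 := hexcut_rot (hexcut_rot (hexcut_rot (hexcut_rot hK))).
have [n5|h5|h5] := neutralP t5.
- have [n3|h3|h3] := neutralP t3.
  + have [n4|h4|h4] := neutralP t4.
    * have /andP[_ h4] := n4.
      by have := no_single wK hK h1 n0 n2 n3 h4 n5.
    * have h4' : t4 <= 1 by rewrite ltW // (lt_trans h4).
      by have := no_single wK hK h1 n0 n2 n3 h4' n5.
    * by have := no_opposite wK hK h1 n0 n3 h4.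
  + have n4 : neutral t4 by case: a34 => // /(neutral_lt0 h3).
    exact: strip_triangle cK wK hK h1 h3 n0 n4 n5.
  + by have := no_pair wK hK h1 h3 n0 n5.
- by have := no_wedge wK hK h5 h1 n0.
have n4 : neutral t4 by case: a45 => // /(neutral_gt1 h5).
have [n3|h3|h3] := neutralP t3.
- by have := no_pair w4 k4 h5 h1 n4 n3.
- by have := no_wedge w4 k4 h3 h5 n4.
by have := no_triple wK hK h1 h3 h5.
Qed.

Lemma hexagon_triangle K t0 t1 t2 t3 t4 t5 :
  convex2 K -> lattice_wide K -> hexagon K t0 t1 t2 t3 t4 t5 ->
  unimod_triangle K.
Proof.
have up L s0 s1 s2 s3 s4 s5 : convex2 L -> lattice_wide L ->
    hexagon L s0 s1 s2 s3 s4 s5 -> 1 < s1 \/ s1 < 0 -> unimod_triangle L.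
  move=> cL wL hL [h|h]; first exact: tilted_hexagon_triangle cL wL hL h.
  (* The reflection fixing w1 turns t1 < 0 into 1 - t1 > 1. *)
  apply/unimod_triangle_rot/unimod_triangle_mir.
  apply: (tilted_hexagon_triangle (convex2_mir (convex2_rot cL))
    (lattice_wide_mir (lattice_wide_rot wL))
    (hexagon_mir (hexagon_rot hL))); lra.
have upr L s0 s1 s2 s3 s4 s5 : convex2 L -> lattice_wide L ->
    hexagon L s0 s1 s2 s3 s4 s5 -> neutral s1 \/ unimod_triangle L.
  move=> cL wL hL; have [|h|h] := neutralP s1; first by left.
    by right; apply: up cL wL hL _; right.
  by right; apply: up cL wL hL _; left.
move=> c0 w0 h0.
have [c1 w1 h1] := And3 (convex2_rot c0) (lattice_wide_rot w0) (hexagon_rot h0).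
have [c2 w2 h2] := And3 (convex2_rot c1) (lattice_wide_rot w1) (hexagon_rot h1).
have [c3 w3 h3] := And3 (convex2_rot c2) (lattice_wide_rot w2) (hexagon_rot h2).
have [c4 w4 h4] := And3 (convex2_rot c3) (lattice_wide_rot w3) (hexagon_rot h3).
have [c5 w5 h5] := And3 (convex2_rot c4) (lattice_wide_rot w4) (hexagon_rot h4).
have [n1|//] := upr _ _ _ _ _ _ _ c0 w0 h0.
have [n2|u] := upr _ _ _ _ _ _ _ c1 w1 h1;
  last by do 1!apply: unimod_triangle_rot.
have [n3|u] := upr _ _ _ _ _ _ _ c2 w2 h2;
  last by do 2!apply: unimod_triangle_rot.
have [n4|u] := upr _ _ _ _ _ _ _ c3 w3 h3;
  last by do 3!apply: unimod_triangle_rot.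
have [n5|u] := upr _ _ _ _ _ _ _ c4 w4 h4;
  last by do 4!apply: unimod_triangle_rot.
have [n0|u] := upr _ _ _ _ _ _ _ c5 w5 h5;
  last by do 5!apply: unimod_triangle_rot.
exact: neutral_triangle c0 w0 (hexagon_cut h0) n0 n1 n2 n3 n4 n5.
Qed.

(** * Admissible bodies and their cuts *)

Definition lattice_free K := forall (m n : int) t, (m, n) != (0, 0) ->
  K (t * m%:~R) (t * n%:~R) -> t <= 1.

Definition around0 K := exists2 e : R, 0 < e &
  forall x y, `|x| <= e -> `|y| <= e -> K x y.

Definition bounded2 K :=
  exists C : R, forall x y, K x y -> `|x| <= C /\ `|y| <= C.

(** What [scaled_admissible] extracts from a product of at least 3. Given [adm_around0], [adm_free]
    means that no nonzero lattice point is interior. *)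
Record admissible K : Prop := Admissible {
  adm_conv : convex2 K ; adm_wide : lattice_wide K ; adm_free : lattice_free K ;
  adm_around0 : around0 K ; adm_bounded : bounded2 K }.

Lemma admissible_rot K : admissible K -> admissible (hex_rot K).
Proof.
move=> [c w f [e e0 h] [C b]]; split;
  [exact: convex2_rot|exact: lattice_wide_rot|..].
- move=> m n t mn; rewrite /hex_rot -mulrN -mulrDr -rmorphN -rmorphD; apply: f.
  apply: contra mn; rewrite !xpair_eqE oppr_eq0 => /andP[/eqP ->].
  by rewrite addr0 => ->; rewrite eqxx.
- exists (e / 2); first by rewrite divr_gt0.
  move=> x y hx hy; apply: h; rewrite ?normrN; first by lra.
  by apply: le_trans (ler_normD _ _) _; lra.
- exists (C + C) => x y /b []; rewrite normrN => hy hxy.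
  split; last by apply: (le_trans hy); rewrite lerDl (le_trans _ hy).
  by rewrite -[x](addrK y); apply: le_trans (ler_normB _ _) _; lra.
Qed.

Lemma admissible_mir K : admissible K -> admissible (hex_mir K).
Proof.
move=> [c w f [e e0 h] [C b]]; split;
  [exact: convex2_mir|exact: lattice_wide_mir|..].
- by move=> m n t mn; apply: f; apply: contra mn; rewrite !xpair_eqE andbC.
- by exists e => // x y hx hy; apply: h.
- by exists C => x y /b [].
Qed.

Lemma admissible_shear K : admissible K -> admissible (hex_shear K).
Proof.
move=> [c w f [e e0 h] [C b]]; split;
  [exact: convex2_shear|exact: lattice_wide_shear|..].
- move=> m n t mn; rewrite /hex_shear -mulrDr -rmorphD; apply: f.
  apply: contra mn; rewrite !xpair_eqE => /andP[] /[swap] /eqP ->.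
  by rewrite addr0 eqxx andbT.
- exists (e / 2); first by rewrite divr_gt0.
  move=> x y hx hy; apply: h; last by lra.
  by apply: le_trans (ler_normD _ _) _; lra.
- exists (C + C) => x y /b [] hxy hy.
  split; last by apply: (le_trans hy); rewrite lerDl (le_trans _ hy).
  by rewrite -[x](addrK y); apply: le_trans (ler_normB _ _) _; lra.
Qed.

Lemma admissible_le1 K y : admissible K -> K 0 y -> y <= 1.
Proof.
move=> [_ _ f _ _] k; apply: (f 0 1) => //.
by rewrite rmorph0 rmorph1 mulr0 mulr1.
Qed.

(** The segment between the points meets the axis through w1, where K ends at height 1. *)
Lemma cross_le K x y x' y' : admissible K -> K x y -> K x' y' ->
  0 < x -> x' < 0 -> y * - x' + y' * x <= x - x'.
Proof.
move=> aK k k' x0 x0'; have d0 : 0 < x - x' by lra.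
have t01 : 0 <= - x' / (x - x') <= 1.
  apply/andP; split; first by apply: divr_ge0; lra.
  by rewrite ler_pdivrMr // mul1r; lra.
have := adm_conv aK k k' t01.
rewrite (_ : _ * x + _ = 0); last by field; rewrite gt_eqF.
move=> /(admissible_le1 aK).
rewrite (_ : _ * y + _ = (y * - x' + y' * x) / (x - x')).
  by rewrite ler_pdivrMr // mul1r.
by field; rewrite gt_eqF.
Qed.

(* A point of K in the open cone of w0 and w1, beyond w1. *)
Definition tall K := exists x y, [/\ K x y, 0 < x & 1 < y].

(** A line of slope - k supports nothing new: y <= 1 + k x separates w1 from K, with t = 1 + k. A
    tilt that no point of K beyond w1 forces is cut back to t = 1 or t = 0. *)
Lemma cut_exists K : admissible K -> exists t,
  [/\ forall x y, K x y -> (1 - t) * x + y <= 1,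
      1 < t -> tall K & t < 0 -> tall (hex_mir (hex_rot K))].
Proof.
move=> aK; have [e e0 he] := adm_around0 aK.
(* Slopes from w1 to points of K on the right; by [cross_le] none exceeds a slope to a point on the
   left, so their supremum serves both sides. *)
pose E := [set z | exists x y, [/\ K x y, 0 < x & z = (y - 1) / x]]%classic.
have ubE x y : K x y -> x < 0 -> ubound E ((1 - y) / - x).
  move=> k x0 z [x' [y' [k' x0' ->]]].
  rewrite ler_pdivrMr // mulrAC ler_pdivlMr ?oppr_gt0 //.
  have := cross_le aK k' k x0' x0; lra.
have E0 : (E !=set0)%classic.
  exists ((0 - 1) / e), e, 0; split => //; apply: he.
    by rewrite gtr0_norm.
  by rewrite normr0 ltW.
have hE : has_ubound E.
  exists ((1 - 0) / - - e); apply: ubE; rewrite ?oppr_lt0 //.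
  by apply: he; [rewrite normrN gtr0_norm|rewrite normr0 ltW].
pose k := sup E.
have kr x y : K x y -> 0 < x -> y <= 1 + k * x.
  move=> h x0; have : (y - 1) / x <= k by apply: ub_le_sup => //; exists x, y.
  by rewrite ler_pdivrMr //; lra.
have kl x y : K x y -> x < 0 -> y <= 1 + k * x.
  move=> h x0; have := ge_sup E0 (ubE _ _ h x0).
  by rewrite -/k ler_pdivlMr ?oppr_gt0 //; lra.
have kc x y : K x y -> y <= 1 + k * x.
  move=> h; have [x0|x0|x0] := ltrgt0P x; [exact: kr|exact: kl|].
  by rewrite x0 mulr0 addr0; apply: admissible_le1 aK _; rewrite -x0.
have [k0|k0] := ltrP 0 k.
  have [T|T] := pselect (tall K).
    by exists (1 + k); split; [move=> x y /kc; lra|by []|lra].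
  exists 1; split; [|by rewrite ltxx|by rewrite ltr10].
  move=> x y h; have [x0|x0] := ltrP 0 x.
    rewrite subrr mul0r add0r leNgt; apply/negP => y1.
    by apply: T; exists x, y.
  by have := kc _ _ h; have := mulr_ge0_le0 (ltW k0) x0; lra.
have [k1|k1] := lerP (-1) k.
  by exists (1 + k); split; [move=> x y /kc; lra|lra|lra].
have [T|T] := pselect (tall (hex_mir (hex_rot K))).
  by exists (1 + k); split; [move=> x y /kc; lra|lra|by []].
exists 0; split; [|by rewrite ltr10|by rewrite ltxx].
move=> x y h; rewrite subr0 mul1r; have [x0|x0] := ltrP x 0.
  rewrite leNgt; apply/negP => y1.
  apply: T; exists (- x), (x + y); split; [|lra|lra].
  by rewrite /hex_mir -hex_rotE.
by have := kc _ _ h; have := mulr_ge0_le0 x0 (_ : k + 1 <= 0); lra.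
Qed.

(** * Removing adjacent tilted lines by change of basis *)

Definition double_tall K := tall K /\ tall (hex_mir K).

Lemma hex_rot3E K x y : iter 3 hex_rot K x y = K (- x) (- y).
Proof. by rewrite /= /hex_rot; congr K; ring. Qed.

Lemma hex_rot6 K : iter 6 hex_rot K = K.
Proof.
by apply/funext => x; apply/funext => y; rewrite /= /hex_rot; congr K; ring.
Qed.

Lemma admissible_iter i K : admissible K -> admissible (iter i hex_rot K).
Proof. by move=> aK; elim: i => //= i; exact: admissible_rot. Qed.

(** Two adjacent lines tilted apart (s < 0, t > 1) make the cone between them double tall; in any
    other tilted pair, a point forcing one tilt violates the other line. *)
Lemma neutral_adj K s t : ~ double_tall K ->
  (forall x y, K x y -> x + s * y <= 1) ->
  (forall x y, K x y -> (1 - t) * x + y <= 1) ->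
  (s < 0 -> tall (hex_mir K)) -> (1 < t -> tall K) ->
  (t < 0 -> tall (hex_mir (hex_rot K))) -> neutral s \/ neutral t.
Proof.
move=> nd c0 c1 hs ht1 ht0.
have [?|h|h] := neutralP t; [by right| |].
  have [x [y [k x0 y1]]] := ht0 h.
  rewrite /hex_mir /hex_rot in k.
  have [?|hs0|hs1] := neutralP s; [by left| |].
    have [x' [y' [k' x0' y1']]] := hs hs0.
    by have := c1 _ _ k'; have := mulr_gt0 (_ : 0 < - t) (_ : 0 < y'); lra.
  have := c0 _ _ k; have := mulr_gt0 (_ : 0 < s - 1) (_ : 0 < y + x); lra.
have [x [y [k x0 y1]]] := ht1 h.
have [?|hs0|hs1] := neutralP s; [by left| |].
  by case: nd; split; [exists x, y|exact: hs].
have := c0 _ _ k; have := mulr_gt0 (_ : 0 < s - 1) (_ : 0 < y); lra.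
Qed.

Definition no_double_tall K :=
  forall i, (i < 6)%N -> ~ double_tall (iter i hex_rot K).

Lemma no_double_tall_triangle K :
  admissible K -> no_double_tall K -> unimod_triangle K.
Proof.
move=> aK nd.
(* [cut_exists] treats w1, so i rotations give the line at w_(i+1), and five give the one at w0. *)
have [t1 [c1 a1 b1]] := cut_exists aK.
have [t2 [c2 a2 b2]] := cut_exists (admissible_iter 1 aK).
have [t3 [c3 a3 b3]] := cut_exists (admissible_iter 2 aK).
have [t4 [c4 a4 b4]] := cut_exists (admissible_iter 3 aK).
have [t5 [c5 a5 b5]] := cut_exists (admissible_iter 4 aK).
have [t0 [c0 a0 b0]] := cut_exists (admissible_iter 5 aK).
have b0' := b0; rewrite -iterS hex_rot6 in b0'.
have h0 : hexcut K t0 t1 t2 t3 t4 t5.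
  split => x y k.
  - have := c0 (- y) (x + y); rewrite /= /hex_rot.
    rewrite (_ : K _ _ = K x y); last by congr K; ring.
    by move/(_ k); lra.
  - exact: c1.
  - have := c2 (x + y) (- x); rewrite /= -hex_rotE; move/(_ k); lra.
  - have := c3 y (- x - y); rewrite /= /hex_rot.
    rewrite (_ : K _ _ = K x y); last by congr K; ring.
    by move/(_ k); lra.
  - have := c4 (- x) (- y); rewrite hex_rot3E !opprK.
    by move/(_ k); lra.
  - have := c5 (- x - y) x; rewrite /= /hex_rot.
    rewrite (_ : K _ _ = K x y); last by congr K; ring.
    by move/(_ k); lra.
have h1 := hexcut_rot h0; have h2 := hexcut_rot h1; have h3 := hexcut_rot h2.
have h4 := hexcut_rot h3; have h5 := hexcut_rot h4.
apply: (@hexagon_triangle K t0 t1 t2 t3 t4 t5 (adm_conv aK) (adm_wide aK)).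
split => //.
- exact: (@neutral_adj K t0 t1 (nd 0%N isT)
    (cut0 h0) (cut1 h0) b0' a1 b1).
- exact: (@neutral_adj (hex_rot K) t1 t2 (nd 1%N isT)
    (cut0 h1) (cut1 h1) b1 a2 b2).
- exact: (@neutral_adj (hex_rot (hex_rot K)) t2 t3 (nd 2%N isT)
    (cut0 h2) (cut1 h2) b2 a3 b3).
- exact: (@neutral_adj (iter 3 hex_rot K) t3 t4 (nd 3%N isT)
    (cut0 h3) (cut1 h3) b3 a4 b4).
- exact: (@neutral_adj (iter 4 hex_rot K) t4 t5 (nd 4%N isT)
    (cut0 h4) (cut1 h4) b4 a5 b5).
- exact: (@neutral_adj (iter 5 hex_rot K) t5 t0 (nd 5%N isT)
    (cut0 h5) (cut1 h5) b5 a0 b0).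
Qed.

Lemma no_cross K x y x' y' : admissible K -> K x y -> K x' y' ->
  0 < x -> x' < 0 -> 1 < y -> 1 < y' -> False.
Proof.
move=> aK k k' x0 x0' y1 y1'; have := cross_le aK k k' x0 x0'.
have := mulr_gt0 (_ : 0 < - x') (_ : 0 < y - 1).
have := mulr_gt0 x0 (_ : 0 < y' - 1); lra.
Qed.

(* The change of basis never has to be undone. *)
Lemma double_tall_shear K : admissible K ->
  double_tall K \/ double_tall (iter 3 hex_rot K) ->
  ~ double_tall (iter 2 hex_rot (hex_shear K)) /\
  ~ double_tall (iter 5 hex_rot (hex_shear K)).
Proof.
have e2 L x y : iter 2 hex_rot (hex_shear L) x y = L (- y) x.
  by rewrite /= /hex_rot /hex_shear; congr L; ring.
have e5 L x y : iter 5 hex_rot (hex_shear L) x y = L y (- x).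
  by rewrite /= /hex_rot /hex_shear; congr L; ring.
have key L : admissible L -> double_tall L ->
    ~ double_tall (iter 2 hex_rot (hex_shear L)) /\
    ~ double_tall (iter 5 hex_rot (hex_shear L)).
  (* A point of another double tall cone would lie across the axis of w1, or of w0, from a point
     given here, and the segment would cross that axis too far out. *)
  move=> aL [[x [y [k x0 y1]]] [x' [y' [k' x0' y1']]]]; split.
    move=> [_ [u [v [h u0 v1]]]]; rewrite /hex_mir e2 in h.
    by apply: (no_cross aL k h); lra.
  move=> [[u [v [h u0 v1]]] _]; rewrite e5 in h.
  by apply: (no_cross (admissible_mir aL) k' (h : hex_mir L _ _)); lra.
move=> aK [d|d]; first exact: key.
have [n2 n5] := key _ (admissible_iter 3 aK) d.
have f2 :
    iter 2 hex_rot (hex_shear (iter 3 hex_rot K)) = iter 5 hex_rot (hex_shear K).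
  by apply/funext => x; apply/funext => y; rewrite e2 e5 hex_rot3E opprK.
have f5 :
    iter 5 hex_rot (hex_shear (iter 3 hex_rot K)) = iter 2 hex_rot (hex_shear K).
  by apply/funext => x; apply/funext => y; rewrite e2 e5 hex_rot3E opprK.
by rewrite -f2 -f5.
Qed.

(** On the open cone the form exceeds k beyond w1 and m beyond w0. *)
Lemma double_tall_lt K (m k : nat) C : (0 < m)%N -> (0 < k)%N ->
  (forall x y, K x y -> `|m%:R * x + k%:R * y| <= C) ->
  double_tall K \/ double_tall (iter 3 hex_rot K) -> m%:R < C /\ k%:R < C.
Proof.
move=> m0 k0.
have key L : (forall x y, L x y -> `|m%:R * x + k%:R * y| <= C) ->
    double_tall L ->
    m%:R < C /\ k%:R < C.
  have m0' : 0 < m%:R :> R by rewrite ltr0n.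
  have k0' : 0 < k%:R :> R by rewrite ltr0n.
  move=> bL [[x [y [k1 x0 y1]]] [x' [y' [k1' x0' y1']]]]; split.
    apply: lt_le_trans (bL _ _ k1'); apply: lt_le_trans (ler_norm _).
    have := mulr_gt0 m0' (_ : 0 < y' - 1); have := mulr_gt0 k0' x0'; lra.
  apply: lt_le_trans (bL _ _ k1); apply: lt_le_trans (ler_norm _).
  have := mulr_gt0 k0' (_ : 0 < y - 1); have := mulr_gt0 m0' x0; lra.
move=> bK [d|d]; first exact: key d.
by apply: key d => x y; rewrite hex_rot3E => /bK; rewrite !mulrN -opprD normrN.
Qed.

(* The form m x + k y stays fixed while the basis changes, so that m + k grows
   at every step although both m and k are bounded by [double_tall_lt]. *)
Lemma double_tall_triangle N K (m k : nat) C :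
  admissible K -> (0 < m)%N -> (0 < k)%N ->
  (forall x y, K x y -> `|m%:R * x + k%:R * y| <= C) ->
  2 * C <= (N + m + k)%:R ->
  double_tall K \/ double_tall (iter 3 hex_rot K) -> unimod_triangle K.
Proof.
elim: N K m k => [|N IH] K m k aK m0 k0 bK hN d.
  have [mC kC] := double_tall_lt m0 k0 bK d.
  by exfalso; rewrite natrD natrD in hN; lra.
apply: unimod_triangle_shear.
have aS := admissible_shear aK.
have [nS|/existsNP[i /not_implyP[i6 /contrapT di]]] :=
  pselect (no_double_tall (hex_shear K)).
  exact: no_double_tall_triangle.
have [n2 n5] := double_tall_shear aK d.
have bS x y : hex_shear K x y -> `|m%:R * x + (m + k)%:R * y| <= C.
  move/bK; rewrite natrD.
  by rewrite (_ : _ * (x + y) + _ = m%:R * x + (m%:R + k%:R) * y) //; ring.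
have bR x y : hex_rot (hex_shear K) x y -> `|(m + k)%:R * x + k%:R * y| <= C.
  move/bS; rewrite natrD.
  by rewrite (_ : m%:R * _ + _ = (m%:R + k%:R) * x + k%:R * y) //; ring.
have direct :
    double_tall (hex_shear K) \/ double_tall (iter 3 hex_rot (hex_shear K)) ->
    unimod_triangle (hex_shear K).
  apply: IH bS _ => //; first by rewrite addn_gt0 m0.
  by apply: (le_trans hN); rewrite ler_nat; lia.
have rotated :
    double_tall (hex_rot (hex_shear K)) \/
    double_tall (iter 3 hex_rot (hex_rot (hex_shear K))) ->
    unimod_triangle (hex_shear K).
  move=> dr; apply: unimod_triangle_rot.
  apply: IH bR _ dr => //; [exact: admissible_rot|by rewrite addn_gt0 m0|].
  by apply: (le_trans hN); rewrite ler_nat; lia.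
(* The old cone splits into the new cones 0 and 1, its opposite into 3 and 4; cones 2 and 5 are
   excluded by [double_tall_shear]. *)
case: i i6 di => [|[|[|[|[|[|//]]]]]] _ di.
- by apply: direct; left.
- by apply: rotated; left.
- by case: n2.
- by apply: direct; right.
- by apply: rotated; right.
- by case: n5.
Qed.

Lemma admissible_triangle K : admissible K -> unimod_triangle K.
Proof.
move=> aK.
have [nK|/existsNP[i /not_implyP[_ /contrapT di]]] :=
  pselect (no_double_tall K).
  exact: no_double_tall_triangle.
have aL := admissible_iter i aK.
suff : unimod_triangle (iter i hex_rot K).
  by elim: i {di aL} => //= i IH /unimod_triangle_rot.
have [C bC] := adm_bounded aL.
(* The descent starts from the form x + y, bounded by C + C. *)
apply: (@double_tall_triangle (Num.truncn (2 * (C + C))) _ 1 1 (C + C)) => //;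
  last by left.
  move=> x y /bC[hx hy]; rewrite !mul1r.
  by apply: le_trans (ler_normD _ _) _; apply: lerD.
by apply: (le_trans (ltW (truncnS_gt _))); rewrite ler_nat !addn1.
Qed.

End PlanarBodies.

(** * Successive minima of bodies in the plane *)

Section Plane.
Context {R : realType}.
Implicit Types (K C : set 'cV[R]_2) (v w : 'cV[R]_2).

Lemma point2_0 (a b : R) : point2 a b 0 0 = a.
Proof. by rewrite mxE. Qed.

Lemma point2_1 (a b : R) : point2 a b 1 0 = b.
Proof. by rewrite mxE. Qed.

Lemma cV2P v w : v 0 0 = w 0 0 -> v 1 0 = w 1 0 -> v = w.
Proof.
move=> h0 h1; apply/matrixP => i j; rewrite (ord1 j).
by case: i => [[|[|//]] hi];
  [move: h0|move: h1]; congr (v _ _ = w _ _); apply: val_inj.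
Qed.

Lemma sum_ord2 (F : 'I_2 -> R) : \sum_(i < 2) F i = F 0 + F 1.
Proof. by rewrite big_ord_recl big_ord1; congr (_ + F _); apply: val_inj. Qed.

Lemma dotvE v w : dotv v w = v 0 0 * w 0 0 + v 1 0 * w 1 0.
Proof. by rewrite /dotv sum_ord2. Qed.

Lemma mulmx2 (U : 'M[int]_2) v i :
  (map_mx intr U *m v) i 0 = (U i 0)%:~R * v 0 0 + (U i 1)%:~R * v 1 0.
Proof. by rewrite mxE sum_ord2 !mxE. Qed.

Lemma convex_set2 K v w t : convex_set K -> 0 <= t <= 1 -> K v -> K w ->
  K (t *: v + (1 - t) *: w).
Proof.
by move=> cK /andP[t0 t1] kv kw; apply: set_mem;
  exact: (cK v w (Itv01 t0 t1) (mem_set kv) (mem_set kw)).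
Qed.

Lemma convex_setE K : convex_set K <->
  forall v w t, 0 <= t <= 1 -> K v -> K w -> K (t *: v + (1 - t) *: w).
Proof.
split=> [cK v w t|cK v w l vK wK]; first exact: convex_set2.
apply: mem_set; apply: (cK v w l%:num); [|exact: set_mem vK|exact: set_mem wK].
by rewrite ge0 le1.
Qed.

(** The left case covers the default value of [least]; a positive [lambda1] excludes it, so
    attainment need not be proved. *)
Lemma lambda1_min C : lambda1 C = 0 \/
  (0 <= lambda1 C /\ forall t, 0 <= t ->
     (exists v, [/\ scale_set t C v, int_lattice v & v != 0]) -> lambda1 C <= t).
Proof.
rewrite /lambda1 /least; case: xgetP => [l ->|]; last by left.
move=> [[l0 _] lb]; right; split => // t t0 [v [v1 v2 v0]]; apply: lb; split => //.
by move/seteqP => [/(_ v)] /= h _; move/eqP: v0; apply; apply: h; split.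
Qed.

(** [C 0] makes the smaller dilates meet the lattice exactly in the origin; an empty intersection
    would count as different from it. *)
Lemma lambda1_eq C l : 0 <= l ->
  (exists v, [/\ scale_set l C v, int_lattice v & v != 0]) ->
  (forall t v, 0 <= t -> t < l -> scale_set t C v -> int_lattice v -> v = 0) ->
  C 0 -> lambda1 C = l.
Proof.
move=> l0 [v [v1 v2 v0]] h C0; apply: xget_unique.
  split.
    split => // /seteqP[/(_ v) /= e _]; move/eqP: v0; apply; apply: e; split => //.
  move=> t [t0 ht]; rewrite leNgt; apply/negP => tl; apply: ht.
  apply/seteqP; split => w /=; first by move=> [w1 w2]; exact: h tl w1 w2.
  move=> ->; split; first by exists 0; rewrite ?scaler0.
  by move=> i; rewrite mxE rpred0.
move=> y [[y0 hy] yl]; apply/eqP; rewrite eq_le; apply/andP; split.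
  apply: yl; split=> // /seteqP[/(_ v) /= e _]; move/eqP: v0; apply; apply: e.
  by split.
rewrite leNgt; apply/negP => tl; apply: hy.
apply/seteqP; split => w /=; first by move=> [w1 w2]; exact: h tl w1 w2.
move=> ->; split; first by exists 0; rewrite ?scaler0.
by move=> i; rewrite mxE rpred0.
Qed.

Definition linform (m n : R) v : R := m * v 0 0 + n * v 1 0.

Lemma linform_max K m n : K !=set0 -> compact K ->
  exists2 v, K v & forall w, K w -> linform m n w <= linform m n v.
Proof.
move=> K0 cK.
have [|v vK h] := compact_EVT_max (f := linform m n) K0 cK.
  have cM (c : R) i : continuous (fun v : 'cV[R]_2 => c * v i 0).
    by move=> v; apply: continuousM; [exact: cst_continuous|exact: coord_continuous].
  apply: continuous_subspaceT => v.
  exact: (continuousD (cM m 0 v) (cM n 1 v)).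
by exists v; [exact: set_mem|move=> w wK; apply: h; exact: mem_set].
Qed.

Lemma interior_around0 K : interior K 0 ->
  exists2 e : R, 0 < e & forall v, `|v 0 0| <= e -> `|v 1 0| <= e -> K v.
Proof.
move=> /nbhs_ballP[e /= e0 he]; exists (e / 2); first by rewrite divr_gt0.
move=> v v0 v1; apply: he; split => // i j; rewrite mxE -ball_normE /= sub0r normrN.
have e2 : e / 2 < e by rewrite ltr_pdivrMr // ltr_pMr // ltr1n.
rewrite (ord1 j); apply: le_lt_trans e2.
by case: i => [[|[|//]] hi];
  [move: v0|move: v1]; congr (`|v _ _| <= _); apply: val_inj.
Qed.

Lemma triangleP v : triangle v <-> in_triangle (v 0 0) (v 1 0).
Proof.
split.
  move=> tv; apply: (@smallest_sub _ (fun C => convex_set C) _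
    [set w | in_triangle (w 0 0) (w 1 0)] _ _ v tv).
    apply/convex_setE => u w t /andP[t0 t1] [a1 a2 a3] [b1 b2 b3].
    rewrite /= !mxE; have s0 : 0 <= 1 - t by lra.
    have := ler_wpM2l t0 a1; have := ler_wpM2l t0 a2; have := ler_wpM2l t0 a3.
    have := ler_wpM2l s0 b1; have := ler_wpM2l s0 b2; have := ler_wpM2l s0 b3.
    by split; lra.
  move=> w; case=> [[|]|] ->; rewrite /= point2_0 point2_1; split; lra.
move=> [h0 h1 h2] C [cC sC].
pose P x y := C (point2 x y).
have cP : convex2 P.
  move=> x y x' y' t k k' t01; rewrite /P.
  have := convex_set2 cC t01 k k'; congr C.
  by apply: cV2P; rewrite !mxE.
(* The weights are the barycentric coordinates of v. *)
have := @convex2_comb3 R P (-1) (-1) (-1) 2 2 (-1)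
  ((1 - v 0 0 - v 1 0) / 3) ((v 1 0 + 1) / 3) ((v 0 0 + 1) / 3) cP
  (sC _ (or_introl (or_introl erefl))) (sC _ (or_introl (or_intror erefl)))
  (sC _ (or_intror erefl)).
rewrite /P (_ : point2 _ _ = v).
  by apply; lra.
by apply: cV2P; rewrite ?point2_0 ?point2_1; lra.
Qed.

(** If K has width at most t > 0 along (m, n), then (m, n) / t lies in the polar of the difference
    body, so the minimum is at most t. *)
Lemma width_lambda1 K (m n : int) : K !=set0 -> compact K ->
  0 < lambda1 (polar (difference_body K)) -> (m, n) != (0, 0) ->
  exists v w, [/\ K v, K w &
    lambda1 (polar (difference_body K)) <=
      linform m%:~R n%:~R v - linform m%:~R n%:~R w].
Proof.
move=> K0 cK mu0 mn; set mu := lambda1 _ in mu0 *.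
have [v kv hv] := linform_max m%:~R n%:~R K0 cK.
have [w kw hw] := linform_max (- m%:~R) (- n%:~R) K0 cK.
exists v, w; split => //; rewrite leNgt; apply/negP => W.
set D := _ - _ in W; have D0 : 0 <= D by rewrite subr_ge0 hv.
have [e|[_ h]] := lambda1_min (polar (difference_body K)).
  by rewrite /mu e ltxx in mu0.
(* The midpoint, unlike the width D, is surely positive. *)
pose t := (D + mu) / 2.
have t0 : 0 < t by rewrite /t; lra.
suff : mu <= t by rewrite /t; lra.
apply: h; first exact: ltW.
exists (point2 m%:~R n%:~R); split.
- exists (t^-1 *: point2 m%:~R n%:~R); last first.
    by rewrite scalerA divff ?scale1r // gt_eqF.
  move=> _ [a ka [b kb <-]]; rewrite dotvE !mxE /=.
  have : t^-1 * D <= 1 by rewrite mulrC ler_pdivrMr // mul1r /t; lra.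
  apply: le_trans.
  rewrite [X in X <= _](_ : _ =
    t^-1 * (linform m%:~R n%:~R a - linform m%:~R n%:~R b)); last first.
    by rewrite /linform; ring.
  rewrite ler_pM2l ?invr_gt0 //.
  by have := hv _ ka; have := hw _ kb; rewrite /D /linform; lra.
- by move=> i; rewrite mxE; case: ifP => _; rewrite intr_int.
- apply: contra mn => /eqP e; rewrite xpair_eqE.
  have := congr1 (fun u : 'cV[R]_2 => u 0 0) e.
  have := congr1 (fun u : 'cV[R]_2 => u 1 0) e.
  by rewrite point2_0 point2_1 !mxE => /eqP + /eqP; rewrite !intr_eq0 => -> ->.
Qed.

Lemma lambda1_gt0 C (D : set 'cV[R]_2) :
  0 < lambda1 C * lambda1 D -> 0 < lambda1 C /\ 0 < lambda1 D.
Proof.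
have ge0 (E : set 'cV[R]_2) : 0 <= lambda1 E by case: (lambda1_min E) => [->|[]].
move=> h; rewrite !lt_neqAle !ge0 !andbT; split; apply: contraTN h.
  by move=> /eqP <-; rewrite mul0r ltxx.
by move=> /eqP <-; rewrite mulr0 ltxx.
Qed.

(** Scaling by [lambda1 K] makes K lattice-free by minimality and multiplies the widths of
    [width_lambda1] to at least 3. *)
Lemma scaled_admissible K : is_convex_body K -> interior K 0 ->
  3 <= lambda1 K * lambda1 (polar (difference_body K)) ->
  admissible (fun x y => K ((lambda1 K)^-1 *: point2 x y)).
Proof.
move=> [K0 cK vK] iK h3.
have [l0 m0] := lambda1_gt0 (lt_le_trans (ltr0n _ 3) h3).
have l1 := divff (lt0r_neq0 l0).
set l := lambda1 K in l0 l1 h3 *; split.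
- move=> x y x' y' t k k' t01; have := convex_set2 vK t01 k k'; congr K.
  by apply: cV2P; rewrite !mxE /=; ring.
- move=> m n mn; have [v [w [kv kw hvw]]] := width_lambda1 K0 cK m0 mn.
  have inK u : K u -> K (l^-1 *: point2 (l * u 0 0) (l * u 1 0)).
    congr K; apply: cV2P; rewrite !mxE /= mulrA mulVf ?mul1r // gt_eqF //.
  exists (l * v 0 0), (l * v 1 0), (l * w 0 0), (l * w 1 0).
  split; [exact: inK|exact: inK|].
  have := ler_wpM2l (ltW l0) hvw; move=> /(le_trans h3); rewrite /linform; lra.
- move=> m n t mn k; rewrite leNgt; apply/negP => t1.
  have t0 : 0 < t by lra.
  have [e|[_ hl]] := lambda1_min K; first by rewrite /l e ltxx in l0.
  (* The smaller dilate by l / t would already contain (m, n). *)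
  suff : l <= l / t by rewrite ler_pdivlMr // ger_pMr //; lra.
  apply: hl; first by rewrite divr_ge0 // ltW.
  exists (point2 m%:~R n%:~R); split.
  + exists (l^-1 *: point2 (t * m%:~R) (t * n%:~R)) => //.
    by apply: cV2P; rewrite !mxE /=; field; rewrite !gt_eqF.
  + by move=> i; rewrite mxE; case: ifP => _; rewrite intr_int.
  + apply: contra mn => /eqP e; rewrite xpair_eqE.
    have := congr1 (fun u : 'cV[R]_2 => u 0 0) e.
    have := congr1 (fun u : 'cV[R]_2 => u 1 0) e.
    by rewrite point2_0 point2_1 !mxE => /eqP + /eqP; rewrite !intr_eq0 => -> ->.
- have [e e0 he] := interior_around0 iK; exists (l * e); first exact: mulr_gt0.
  move=> x y hx hy; apply: he; rewrite !mxE /= normrM (@gtr0_norm _ l^-1) ?invr_gt0 //.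
    by rewrite mulrC ler_pdivrMr // mulrC.
  by rewrite mulrC ler_pdivrMr // mulrC.
have [v1 _ h1] := linform_max 1 0 K0 cK.
have [v2 _ h2] := linform_max (-1) 0 K0 cK.
have [v3 _ h4] := linform_max 0 1 K0 cK.
have [v4 _ h5] := linform_max 0 (-1) K0 cK.
pose C := `|linform 1 0 v1| + `|linform (-1) 0 v2|
  + `|linform 0 1 v3| + `|linform 0 (-1) v4|.
exists (l * C) => x y k.
have a1 := ler_norm (linform 1 0 v1); have a2 := ler_norm (linform (-1) 0 v2).
have a3 := ler_norm (linform 0 1 v3); have a4 := ler_norm (linform 0 (-1) v4).
have b1 := normr_ge0 (linform 1 0 v1); have b2 := normr_ge0 (linform (-1) 0 v2).
have b3 := normr_ge0 (linform 0 1 v3); have b4 := normr_ge0 (linform 0 (-1) v4).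
have := h1 _ k; have := h2 _ k; have := h4 _ k; have := h5 _ k.
rewrite {1 3 5 7}/linform !mxE /= => c4 c3 c2 c1.
have bx : `|l^-1 * x| <= C by rewrite ler_norml /C; apply/andP; split; lra.
have by' : `|l^-1 * y| <= C by rewrite ler_norml /C; apply/andP; split; lra.
have fin z : `|l^-1 * z| <= C -> `|z| <= l * C.
  by rewrite normrM (@gtr0_norm _ l^-1) ?invr_gt0 // ler_pdivrMl.
by split; apply: fin.
Qed.

Lemma triangle_image_of_scaled K (l : R) : 0 < l ->
  unimod_triangle (fun x y => K (l^-1 *: point2 x y)) ->
  exists (k : R) (U : 'M[int]_2),
    [/\ 0 < k, U \in unitmx & K = scale_set k (int_mx_image U triangle)].
Proof.
move=> l0 [p [q [r [s [d h]]]]].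
have ln : l != 0 by rewrite gt_eqF.
pose e := p * s - q * r.
have ee : e * e = 1 by rewrite /e; case: d => ->.
have eeR : (e%:~R : R) * e%:~R = 1 by rewrite -rmorphM ee.
(* As e is 1 or -1, the inverse of V is e times its adjugate. *)
pose U : 'M[int]_2 := \matrix_(i < 2, j < 2)
  if i == 0 then (if j == 0 then e * s else - (e * q))
  else (if j == 0 then - (e * r) else e * p).
pose V : 'M[int]_2 := \matrix_(i < 2, j < 2)
  if i == 0 then (if j == 0 then p else q) else (if j == 0 then r else s).
have UV : V *m U = 1%:M.
  apply/matrixP => i j; rewrite !mxE big_ord_recl big_ord1 !mxE /=.
  case: i => [[|[|//]] hi]; case: j => [[|[|//]] hj];
    rewrite /eqE /= ?mulr1n ?mulr0n -?[RHS]ee /e; ring.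
exists l^-1, U; split; first by rewrite invr_gt0.
  by have [] := mulmx1_unit UV.
have hE : (e%:~R : R) = p%:~R * s%:~R - q%:~R * r%:~R.
  by rewrite /e rmorphB !rmorphM.
apply/seteqP; split => v.
  move=> kv.
  pose w : 'cV[R]_2 := point2 (p%:~R * (l * v 0 0) + q%:~R * (l * v 1 0))
    (r%:~R * (l * v 0 0) + s%:~R * (l * v 1 0)).
  exists (map_mx intr U *m w).
    exists w => //; apply/triangleP; rewrite point2_0 point2_1; apply/h.
    move: kv; congr K; apply: cV2P; rewrite !mxE /= mulrA mulVf ?mul1r //.
  apply: cV2P; rewrite mxE mulmx2 point2_0 point2_1 !mxE /= ?rmorphN !rmorphM /=.
    have -> : l^-1 * (e%:~R * s%:~R * (p%:~R * (l * v 0 0) + q%:~R * (l * v 1 0)) +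
      - (e%:~R * q%:~R) * (r%:~R * (l * v 0 0) + s%:~R * (l * v 1 0))) =
      l^-1 * l * (e%:~R * (p%:~R * s%:~R - q%:~R * r%:~R)) * v 0 0 by ring.
    by rewrite -hE eeR mulVf // !mul1r.
  have -> : l^-1 * (- (e%:~R * r%:~R) * (p%:~R * (l * v 0 0) + q%:~R * (l * v 1 0)) +
      e%:~R * p%:~R * (r%:~R * (l * v 0 0) + s%:~R * (l * v 1 0))) =
      l^-1 * l * (e%:~R * (p%:~R * s%:~R - q%:~R * r%:~R)) * v 1 0 by ring.
  by rewrite -hE eeR mulVf // !mul1r.
move=> [_ [w /triangleP tw <-] <-].
pose x := (map_mx intr U *m w : 'cV[R]_2) 0 0.
pose y := (map_mx intr U *m w : 'cV[R]_2) 1 0.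
rewrite (_ : map_mx intr U *m w = point2 x y); last first.
  by apply: cV2P; rewrite ?point2_0 ?point2_1.
apply/h; rewrite /x /y !mulmx2 !mxE /= ?rmorphN !rmorphM /=.
rewrite (_ : p%:~R * _ + _ =
  (e%:~R * (p%:~R * s%:~R - q%:~R * r%:~R)) * w 0 0); last by ring.
rewrite (_ : r%:~R * _ + _ =
  (e%:~R * (p%:~R * s%:~R - q%:~R * r%:~R)) * w 1 0); last by ring.
by rewrite -hE eeR !mul1r.
Qed.

Lemma small_intP (x y : R) : x \is a Num.int -> y \is a Num.int ->
  -1 < x -> -1 < y -> x + y < 1 -> x = 0 /\ y = 0.
Proof.
move=> /intrP[m ->] /intrP[n ->] hm hn hmn.
have hm' : -1 < m by rewrite -(ltr_int R) rmorphN1.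
have hn' : -1 < n by rewrite -(ltr_int R) rmorphN1.
have hmn' : m + n < 1 by rewrite -(ltr_int R) rmorphD rmorph1.
by have [-> ->] : m = 0 /\ n = 0 by lia.
Qed.

Lemma small_int_mul3 (x : R) : x \is a Num.int -> `|3 * x| < 3 -> x = 0.
Proof.
move=> /intrP[m ->]; rewrite normrM ger0_norm // gtr_pMr // -intr_norm.
rewrite -[X in _ < X](rmorph1 intr) ltr_int => h.
by have -> : m = 0 by lia.
Qed.

Lemma lattice_mul (U : 'M[int]_2) v :
  int_lattice v -> int_lattice (map_mx intr U *m v).
Proof. by move=> hv i; rewrite mulmx2 rpredD ?rpredM ?intr_int. Qed.

Lemma lattice_point2 (m n : int) : int_lattice (point2 m%:~R n%:~R : 'cV[R]_2).
Proof. by move=> i; rewrite mxE; case: ifP => _; rewrite intr_int. Qed.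

(** * The two successive minima of the extremal triangles *)

Section TriangleImage.
Variables (l : R) (U : 'M[int]_2).
Hypotheses (l0 : 0 < l) (unitU : U \in unitmx).
Let K := scale_set l (int_mx_image U triangle) : set 'cV[R]_2.
Let Ur := map_mx intr U : 'M[R]_2.
Let Vr := map_mx intr (invmx U) : 'M[R]_2.

Let VU : Vr *m Ur = 1%:M.
Proof. by rewrite -map_mxM mulVmx // map_mx1. Qed.

Let UV : Ur *m Vr = 1%:M.
Proof. by rewrite -map_mxM mulmxV // map_mx1. Qed.

Let KP v : K v <->
  exists2 w : 'cV[R]_2, in_triangle (w 0 0) (w 1 0) & v = l *: (Ur *m w).
Proof.
split=> [[_ [w /triangleP tw <-] <-]|[w tw ->]]; first by exists w.
by exists (Ur *m w) => //; exists w => //; apply/triangleP.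
Qed.

Lemma lambda1_triangle : lambda1 K = l^-1.
Proof.
have ln : l != 0 by rewrite gt_eqF.
apply: lambda1_eq.
- by rewrite invr_ge0 ltW.
(* (1, 0) is a lattice point on the boundary of the triangle. *)
- exists (Ur *m point2 1%:~R 0%:~R); split.
  + exists (l *: (Ur *m point2 1%:~R 0%:~R)); last first.
      by rewrite scalerA mulVf // scale1r.
    apply/KP; exists (point2 1%:~R 0%:~R) => //.
    by rewrite point2_0 point2_1; split; lra.
  + exact/lattice_mul/lattice_point2.
  + apply/eqP => /(congr1 (mulmx Vr)); rewrite mulmxA VU mul1mx mulmx0.
    move=> /(congr1 (fun u : 'cV[R]_2 => u 0 0)); rewrite point2_0 mxE.
    by move/eqP; rewrite oner_eq0.
- move=> t v t0 tl [_ /KP[w [w0 w1 w2] ->] <-] lat.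
  have e : Vr *m (t *: (l *: (Ur *m w))) = (t * l) *: w.
    by rewrite scalerA -scalemxAr mulmxA VU mul1mx.
  have := lattice_mul (invmx U) lat; rewrite -/Vr e => {}lat.
  have tl1 : t * l < 1 by rewrite -ltr_pdivlMr // mul1r.
  have tl0 : 0 <= t * l by apply: mulr_ge0 => //; exact: ltW.
  have := lat 0; have := lat 1; rewrite !mxE => i1 i0.
  have [z0 z1] : t * l * w 0 0 = 0 /\ t * l * w 1 0 = 0.
    apply: small_intP => //.
    - by have := ler_wpM2l tl0 w0; lra.
    - by have := ler_wpM2l tl0 w1; lra.
    - by have := ler_wpM2l tl0 w2; lra.
  rewrite scalerA scalemxAr (_ : (t * l) *: w = 0) ?mulmx0 //.
  by apply: cV2P; rewrite !mxE.
- by apply/KP; exists 0; rewrite ?mulmx0 ?scaler0 // !mxE; split; lra.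
Qed.

Lemma lambda1_triangle_polar : lambda1 (polar (difference_body K)) = 3 * l.
Proof.
have ln : l != 0 by rewrite gt_eqF.
have l3 : 0 < 3 * l by apply: mulr_gt0.
(* The dual lattice vector that reads off the first triangle coordinate, along which the triangle
   has width 3. *)
pose u : 'cV[R]_2 := map_mx intr (invmx U)^T *m point2 1%:~R 0%:~R.
have du w : dotv (Ur *m w) u = w 0 0.
  have := congr1 (fun M : 'cV[R]_2 => M 0 0) (mul1mx w).
  rewrite -VU -mulmxA /= mxE sum_ord2 => <-.
  by rewrite dotvE !(mulmx2 (invmx U)^T) !mxE /=; ring.
apply: lambda1_eq.
- exact: ltW.
- exists u; split.
  + exists ((3 * l)^-1 *: u); last by rewrite scalerA divff ?scale1r // gt_eqF.
    move=> _ [_ /KP[w [w0 w1 w2] ->] [_ /KP[z [z0 z1 z2] ->] <-]].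
    have -> : dotv (l *: (Ur *m w) - l *: (Ur *m z)) ((3 * l)^-1 *: u) =
      (dotv (Ur *m w) u - dotv (Ur *m z) u) / 3.
      by rewrite !dotvE; move: (Ur *m w) (Ur *m z) => a b; rewrite !mxE; field.
    by rewrite !du; lra.
  + exact/lattice_mul/lattice_point2.
  + apply/eqP => e; have := du (point2 1 0).
    by rewrite e point2_0 dotvE !mxE !mulr0 addr0 => /eqP; rewrite eq_sym oner_eq0.
- move=> t v t0 tl [y py <-] lat.
  (* The same form in triangle coordinates: c is integral, and vertex differences (3, 0) and (0, 3)
     give |3 c_i| < 3, so c = 0. *)
  pose c : 'cV[R]_2 := map_mx intr U^T *m (t *: y).
  have dc w : dotv (Ur *m w) (t *: y) = dotv w c.
    rewrite /c !dotvE !(mulmx2 U) !(mulmx2 U^T) !mxE; ring.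
  have lc : int_lattice c by exact: lattice_mul.
  have bnd w (z : 'cV[R]_2) :
      in_triangle (w 0 0) (w 1 0) -> in_triangle (z 0 0) (z 1 0) ->
      dotv w c - dotv z c < 3.
    move=> tw tz; rewrite -!dc -(ltr_pM2l l0).
    have : dotv (l *: (Ur *m w) - l *: (Ur *m z)) y <= 1.
      by apply: py; exists (l *: (Ur *m w)); [apply/KP; exists w|
        exists (l *: (Ur *m z)) => //; apply/KP; exists z].
    move=> /(ler_wpM2l t0); rewrite !dotvE.
    by move: (Ur *m w) (Ur *m z) => a b; rewrite !mxE; lra.
  have v0 : in_triangle (-1 : R) (-1) by split; lra.
  have v1 : in_triangle (2 : R) (-1) by split; lra.
  have v2 : in_triangle (-1 : R) 2 by split; lra.
  have B (a b a' b' : R) : in_triangle a b -> in_triangle a' b' ->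
      (a - a') * c 0 0 + (b - b') * c 1 0 < 3.
    move=> h h'; have := bnd (point2 a b) (point2 a' b').
    rewrite !point2_0 !point2_1 !dotvE !point2_0 !point2_1 => /(_ h h'); lra.
  have c0 : c 0 0 = 0.
    apply: small_int_mul3 (lc 0) _; rewrite ltr_norml.
    by have := B _ _ _ _ v1 v0; have := B _ _ _ _ v0 v1 => *; apply/andP; split; lra.
  have c1 : c 1 0 = 0.
    apply: small_int_mul3 (lc 1) _; rewrite ltr_norml.
    by have := B _ _ _ _ v2 v0; have := B _ _ _ _ v0 v2 => *; apply/andP; split; lra.
  have z x : dotv x (t *: y) = 0.
    by rewrite -[x]mul1mx -UV -mulmxA dc dotvE c0 c1 !mulr0 addr0.
  apply: cV2P.
    by have := z (point2 1 0); rewrite dotvE point2_0 point2_1 mul1r mul0r addr0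
      => ->; rewrite mxE.
  by have := z (point2 0 1); rewrite dotvE point2_0 point2_1 mul1r mul0r add0r
    => ->; rewrite mxE.
- by move=> x _; rewrite dotvE !mxE !mulr0 addr0 ler01.
Qed.

End TriangleImage.

End Plane.

Theorem corollary1p3 (R : realType) (K : set 'cV[R]_2)
    (K_body : is_convex_body K) (K_int : interior K 0) :
  lambda1 K * lambda1 (polar (difference_body K)) <= 3 /\
  (lambda1 K * lambda1 (polar (difference_body K)) = 3 <->
   exists (l : R) (U : 'M[int]_2),
     [/\ 0 < l, U \in unitmx &
         K = scale_set l (int_mx_image U triangle)]).
Proof.
have shape : 3 <= lambda1 K * lambda1 (polar (difference_body K)) ->
    exists (l : R) (U : 'M[int]_2),
      [/\ 0 < l, U \in unitmx & K = scale_set l (int_mx_image U triangle)].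
  move=> h; have [l0 _] := lambda1_gt0 (lt_le_trans (ltr0n _ 3) h).
  exact: triangle_image_of_scaled l0
    (admissible_triangle (scaled_admissible K_body K_int h)).
have value : (exists (l : R) (U : 'M[int]_2),
      [/\ 0 < l, U \in unitmx & K = scale_set l (int_mx_image U triangle)]) ->
    lambda1 K * lambda1 (polar (difference_body K)) = 3.
  move=> [l [U [l0 uU ->]]].
  rewrite lambda1_triangle // lambda1_triangle_polar // mulrCA mulVf ?mulr1 //.
  by rewrite gt_eqF.
split; last by split=> [e|//]; apply: shape; rewrite e.
by rewrite leNgt; apply/negP => h; have := h; rewrite value ?ltxx //; apply/shape/ltW.
Qed.
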